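(* Let $\bm{X}^{(1)}=\{\bm{X}^{(1)}_1,\ldots,\bm{X}^{(1)}_{n_1}\}$ be an i.i.d. sample from the mother distribution and $\bm{X}^{(2)}=\{\bm{X}^{(2)}_1,\ldots,\bm{X}^{(2)}_{n_2}\}$ an i.i.d. sample from the model distribution, where both are continuous distributions on $\mathcal{X}\subseteq\mathbb{R}^k$ and the two samples are independent. Let $\{A_{\bm{j}(l)}\}_{\bm{j}(l)}$ be the moving region partition of depth $l\le k$ of $\mathcal{X}$ constructed from $\bm{X}^{(2)}$. Let $m^{(1)},m^{(2)}$ be the discretized mother and model distributions over these regions, and $\hat m^{(1)},\hat m^{(2)}$ their estimators, as defined in the context. For probability vectors $q=\{q_{\bm{j}(l)}\}$ and $r=\{r_{\bm{j}(l)}\}$ put $$D[q:r]=2\sum_{\bm{j}(l)}\bigl(\sqrt{q_{\bm{j}(l)}}-\sqrt{r_{\bm{j}(l)}}\bigr)^2,\qquad ED[q:r]=E\bigl[D[q:r]\bigr].$$ Then, as $n_1,n_2\to\infty$, $$ED[m^{(1)}:m^{(2)}]\ \le\ ED[\hat m^{(1)}:\hat m^{(2)}]+\frac{\sqrt{8p'}}{\sqrt{n_2}}+o(n_1^{-1})+o(n_2^{-1/2}),$$ where $p'$ is the total number of regions $A_{\bm{j}(l)}$ of the partition minus one.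
   Context: The domain is $\mathcal{X}=[a_1,b_1]\times\cdots\times[a_k,b_k]$ ($a_i=-\infty$ and $b_i=\infty$ are allowed). $D$ is the Hellinger distance (the $f$-divergence $D_f[q:r]=\sum_i q_i f(r_i/q_i)$ with $f(x)=2(1-\sqrt{x})^2$). Expectations are over both samples. Moving region partition of depth $l$ ($1\le l\le k$) based on $\bm{X}^{(2)}$. Write $n=n_2$ and $\bm{j}(i)=(j_1,\ldots,j_i)$. Fix (independently of the sample sizes) a nonnegative integer $p$ and, for each $i=2,\ldots,l$ and each index $\bm{j}(i-1)$, a nonnegative integer $p_{\bm{j}(i-1)}$. Step 1: let $X_1(1)\le\cdots\le X_1(n)$ be the order statistics of the first coordinates of the sample $\bm{X}^{(2)}$. Put $\tilde n_j=\lfloor nj/(p+1)\rfloor$ for $j=0,\ldots,p+1$, and $I_j=(X_1(\tilde n_j),X_1(\tilde n_{j+1})]$ for $j=0,\ldots,p$, where $X_1(\tilde n_0)$ is replaced by $a_1$ and $X_1(\tilde n_{p+1})$ by $b_1$. Set $A_j=\{\bm{X}\in\mathcal{X}\mid X_1\in I_j\}$. Step $i$ ($i=2,\ldots,l$): for each region $A_{\bm{j}(i-1)}$ from the previous step, let $n(A_{\bm{j}(i-1)})$ be the number of points of $\bm{X}^{(2)}$ assigned to it (the points whose ranks at each step fall in the corresponding rank range; for example $n(A_j)=\tilde n_{j+1}-\tilde n_j$). Let $X_{\bm{j}(i-1)i}(1)\le\cdots\le X_{\bm{j}(i-1)i}(n(A_{\bm{j}(i-1)}))$ be the order statistics of the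 $i$th coordinates of those points. Put $\tilde n_{\bm{j}(i-1),s}=\lfloor n(A_{\bm{j}(i-1)})\,s/(p_{\bm{j}(i-1)}+1)\rfloor$ for $s=0,\ldots,p_{\bm{j}(i-1)}+1$. For $j_i=0,\ldots,p_{\bm{j}(i-1)}$ let $I_{\bm{j}(i)}=(X_{\bm{j}(i-1)i}(\tilde n_{\bm{j}(i-1),j_i}),\,X_{\bm{j}(i-1)i}(\tilde n_{\bm{j}(i-1),j_i+1})]$, where the lowest endpoint ($s=0$) is $a_i$ and the highest ($s=p_{\bm{j}(i-1)}+1$) is $b_i$. Set $A_{\bm{j}(i)}=\{\bm{X}\in A_{\bm{j}(i-1)}\mid X_i\in I_{\bm{j}(i)}\}$. After step $l$, the mutually exclusive regions $A_{\bm{j}(l)}$, with $\bm{j}(l)$ running over all possible indices, partition $\mathcal{X}$. Discretized distributions (random, through the dependence of the regions on $\bm{X}^{(2)}$; the probabilities are computed with the regions held fixed): $m^{(1)}_{\bm{j}(l)}=P(\bm{X}\in A_{\bm{j}(l)}\mid\text{the mother distribution})$ and $m^{(2)}_{\bm{j}(l)}=P(\bm{X}\in A_{\bm{j}(l)}\mid\text{the model distribution})$. Estimators: $\hat m^{(1)}_{\bm{j}(l)}=\#\{\tau : \bm{X}^{(1)}_\tau\in A_{\bm{j}(l)}\}/n_1$ and $\hat m^{(2)}_{\bm{j}(l)}=1/(p'_{\bm{j}(l-1)}+1)$, where $p'_{\bm{j}(l-1)}=(p+1)(p_{\bm{j}(1)}+1)\cdots(p_{\bm{j}(l-1)}+1)-1$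 (for $l=1$ the product is just $p+1$). *)

(* Defs.v *)
From HB Require Import structures.
From mathcomp Require Import all_boot all_order all_algebra.
From mathcomp Require Import all_classical all_reals all_analysis.
Set Implicit Arguments.
Unset Strict Implicit.
Unset Printing Implicit Defensive.
Import Order.TTheory GRing.Theory Num.Theory.
Import numFieldNormedType.Exports.
Local Open Scope classical_set_scope.
Local Open Scope ring_scope.

(* Points of R^k are k-tuples, with the product sigma-algebra.  Coordinates are
   counted from 0, so X_1 is coordinate 0, and step i cuts along coordinate
   i - 1. *)

Definition box (R : realType) (k : nat) (a b : k.-tuple (\bar R)) :
    set (k.-tuple R) :=
  [set x | forall i, (tnth a i <= (tnth x i)%:E <= tnth b i)%E].

Definition joint_cdf (R : realType) (k : nat)
    (mu : probability (k.-tuple R) R) (x : 'rV[R]_k) : R :=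
  fine (mu [set y : k.-tuple R | forall i, tnth y i <= x ord0 i]).

Definition continuous_distribution (R : realType) (k : nat)
    (mu : probability (k.-tuple R) R) : Prop :=
  continuous (joint_cdf mu).

Definition mutually_independent (d d' : measure_display)
    (Omega : measurableType d) (T : measurableType d') (R : realType)
    (P : probability Omega R) (n : nat) (X : 'I_n -> {RV P >-> T}) : Prop :=
  forall (J : {set 'I_n}) (B : 'I_n -> set T),
    (forall i, measurable (B i)) ->
    P [set w | forall i, i \in J -> B i (X i w)] =
    (\prod_(i in J) P (X i @^-1` B i))%E.

Definition iid (d d' : measure_display)
    (Omega : measurableType d) (T : measurableType d') (R : realType)
    (P : probability Omega R) (n : nat) (X : 'I_n -> {RV P >-> T})
    (mu : probability T R) : Prop :=
  mutually_independent X /\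
  forall i B, measurable B -> distribution P (X i) B = mu B.

Definition sample (d d' : measure_display)
    (Omega : measurableType d) (T : measurableType d') (R : realType)
    (P : probability Omega R) (n : nat) (X : 'I_n -> {RV P >-> T})
    (w : Omega) : n.-tuple T :=
  [tuple X i w | i < n].

Definition independent_samples (d d' : measure_display)
    (Omega : measurableType d) (T : measurableType d') (R : realType)
    (P : probability Omega R) (n1 n2 : nat)
    (X1 : 'I_n1 -> {RV P >-> T}) (X2 : 'I_n2 -> {RV P >-> T}) : Prop :=
  forall (B1 : set (n1.-tuple T)) (B2 : set (n2.-tuple T)),
    measurable B1 -> measurable B2 ->
    P (sample X1 @^-1` B1 `&` sample X2 @^-1` B2) =
    (P (sample X1 @^-1` B1) * P (sample X2 @^-1` B2))%E.

(* A multi-index j(i) = (j_1, ..., j_i) is a sequence of length i.  One function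
   p holds all the parameters of the partition: p [::] is the p of the first
   step and p j(i) is p_{j(i)}; its values at sequences that are not indices of
   regions are irrelevant. *)

(* The possible indices j(i), i.e. those with j_1 <= p [::], j_2 <= p j(1), ... *)
Fixpoint indices (p : seq nat -> nat) (i : nat) : seq (seq nat) :=
  if i is i'.+1 then
    [seq rcons j s | j <- indices p i', s <- iota 0 (p j).+1]
  else [:: [::]].

(* The rank n~_s, i.e. the floor of n s / (q + 1). *)
Definition cut_rank (q n s : nat) : nat := (n * s %/ q.+1)%N.

(* The points of the sample xs assigned to A_{j(i)}, where j(i) is take i j.
   From the points of A_{j(i-1)}, sorted by X_i, keep those of ranks
   n~_{j_i} + 1, ..., n~_{j_i + 1} (ranks counted from 1).  Ties, which have
   probability 0 for a continuous distribution, are broken by sample order. *)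
Fixpoint assigned (R : realType) (k : nat) (p : seq nat -> nat)
    (xs : seq (k.-tuple R)) (j : seq nat) (i : nat) : seq (k.-tuple R) :=
  if i is i'.+1 then
    let s := nth 0%N j i' in
    let ys := assigned p xs j i' in
    let rk := cut_rank (p (take i' j)) (size ys) in
    drop (rk s) (take (rk s.+1)
      (sort (fun x y : k.-tuple R => x`_i' <= y`_i') ys))
  else xs.

(* Endpoint number s of the intervals dividing A_{j(i)} along coordinate i.
   The order statistic of rank r is the entry r.-1 of the sorted sequence; when
   A_{j(i)} has at most p_{j(i)} points, rank 0 can occur for s > 0, where the
   construction is undefined, and it is then read as rank 1. *)
Definition cutpoint (R : realType) (k : nat) (a b : k.-tuple (\bar R))
    (p : seq nat -> nat) (xs : seq (k.-tuple R)) (j : seq nat) (i s : nat) :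
    \bar R :=
  let q := p (take i j) in
  let ys := assigned p xs j i in
  if s == 0%N then nth -oo%E a i
  else if s == q.+1 then nth +oo%E b i
  else ((sort <=%R [seq x`_i | x : k.-tuple R <- ys])`_
          (cut_rank q (size ys) s).-1)%:E.

Definition region (R : realType) (k : nat) (a b : k.-tuple (\bar R))
    (p : seq nat -> nat) (xs : seq (k.-tuple R)) (j : seq nat) :
    set (k.-tuple R) :=
  [set x | box a b x /\
    forall i, (i < size j)%N ->
      (cutpoint a b p xs j i (nth 0%N j i) < (x`_i)%:E
         <= cutpoint a b p xs j i (nth 0%N j i).+1)%E].

Definition discretized (R : realType) (k : nat)
    (mu : probability (k.-tuple R) R) (A : seq nat -> set (k.-tuple R))
    (j : seq nat) : R :=
  fine (mu (A j)).

Definition empirical (R : realType) (k n : nat) (xs : n.-tuple (k.-tuple R))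
    (A : seq nat -> set (k.-tuple R)) (j : seq nat) : R :=
  (count (fun x => x \in A j) xs)%:R / n%:R.

(* 1 / (p'_{j(l-1)} + 1), where l = size j. *)
Definition nominal (R : realType) (p : seq nat -> nat) (j : seq nat) : R :=
  (\prod_(i < size j) (p (take i j)).+1)%N%:R^-1.

Definition divergence (R : realType) (J : seq (seq nat)) (q r : seq nat -> R) :
    R :=
  2 * \sum_(j <- J) (Num.sqrt (q j) - Num.sqrt (r j)) ^+ 2.

(* Main.v *)
(* Write r_j for the nominal probabilities, m_j for the model probabilities of the
   regions, n for n_2, and H for the sum of the squares (sqrt m_j - sqrt r_j)^2.
   By Jensen's inequality given X^(2), the empirical frequencies have a larger
   expected divergence from r than m^(1) has, so no error term in n_1 arises.  By
   the inequality of Cauchy and Schwarz, replacing r by m costs at most 4 sqrt(E H),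
   and it remains to see that E H <= p'/(2n) + O(n^-2).
   Unless some m_j exceeds r_j by a fixed factor, H is at most half the chi-square
   distance, that is half of (sum of m_j^2 / r_j) - 1, so upper bounds on the moments
   E m_j^a suffice.  E m_j^a is the probability that a new points fall in A_j.  By
   exchangeability it is the mean proportion of the choices of a points among n + a
   that fall in the region of index j built from the other n.  The chosen points must
   then belong to a set determined by the whole configuration, found by running
   the construction with the upper ranks shifted by a and dropping the upper
   endpoints of the cells.  This set has n r_j + O(1) points, and the sizes sum to at
   most n + a + (a - 1) p'.  With a = 2 this gives a mean chi-square distance of at
   most p'/n + O(n^-2); with a proportional to n it makes the exceptional event
   exponentially unlikely. *)

Require Import Defs.
From HB Require Import structures.
From mathcomp Require Import all_boot all_order all_algebra perm action alt primitive_action.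
From mathcomp Require Import all_classical all_reals all_analysis measurable_realfun.
From mathcomp Require Import zify ring lra.
Set Implicit Arguments.
Unset Strict Implicit.
Unset Printing Implicit Defensive.
Import Order.TTheory GRing.Theory Num.Theory.
Import numFieldNormedType.Exports.
Local Open Scope classical_set_scope.
Local Open Scope ring_scope.

(** * Rank cells of a configuration of points *)

(** The obstacle is the constant, which is decided by bounded terms in the counts. If the set for
    region j has u_j = n r_j + eta_j points and S is the sum of the eta_j, the second moments give a
    mean chi-square distance of about (2 S - p' - 4) / n. Whole cells have two points more than the
    regions of the sample, so that S = 2 p' + 2 and the bound would be 3 p' / n. The upper endpoint
    of a cell, unless the cell is the last of its level, is an old point; leaving it out lowers S to
    at most p' + 2, and the bound becomes p' / n. The individual eta_j are known only up to O(1),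
    because of the floors, but the factor n multiplies only their sum; so the regions have to be
    summed before anything is estimated. The exceptional event has to be negligible against 1/n.
    Chebyshev's inequality would give a multiple of 1/n, and Markov's inequality for a raw moment of
    fixed order only a constant; hence the order proportional to n. *)

Section RankCells.
Variables (R : realDomainType) (T : eqType) (key : nat -> T -> R).
Variable p : seq nat -> nat.
Implicit Types (ys : seq T) (j : seq nat) (i s n a : nat).

Definition rank i ys x := count (fun y => key i y < key i x) ys.

Lemma rank_mono i ys x y : key i x <= key i y -> (rank i ys x <= rank i ys y)%N.
Proof. by move=> xy; apply: sub_count => z /= /lt_le_trans; apply. Qed.

Lemma rank_lt_size i ys x : x \in ys -> (rank i ys x < size ys)%N.
Proof.
move=> xys; rewrite -(count_predC (fun y => key i y < key i x)) -addn1 leq_add2l.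
by rewrite -has_count; apply/hasP; exists x => //=; rewrite ltxx.
Qed.

Lemma perm_rank i ys zs x : perm_eq ys zs -> rank i ys x = rank i zs x.
Proof. by move/seq.permP; apply. Qed.

Lemma sorted_map_rank i ys : sorted <%O (map (key i) ys) ->
  map (rank i ys) ys = iota 0 (size ys).
Proof.
move=> sys; case: ys sys => // x0 ys0; set ys := x0 :: ys0 => sys.
have sle : sorted <=%O (map (key i) ys) by move: sys; rewrite lt_sorted_uniq_le => /andP[].
apply: (@eq_from_nth _ 0%N); rewrite ?size_map ?size_iota // => m mys.
rewrite nth_iota // add0n (nth_map x0) // /rank.
rewrite -[LHS]/(count (preim (key i) (< key i (nth x0 ys m))) ys) -count_map.
rewrite -(nth_map x0 (key i x0)) //; set vs := map _ _ in sys sle *.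
have mvs : (m < size vs)%N by rewrite size_map.
set v := nth _ _ m; case: (ltngtP (count (< v) vs) m) => // cm.
- have := nth_count_ge (key i x0) sle (x := v) (i := count (< v) vs).
  rewrite leqnn (ltn_trans cm mvs) => /(_ isT); rewrite leNgt.
  by rewrite lt_sorted_ltn_nth // ?inE ?cm // (ltn_trans cm mvs).
- by have := nth_count_lt (key i x0) sle cm; rewrite ltxx.
Qed.

Lemma sort_key_sorted i ys : uniq (map (key i) ys) ->
  sorted <%O (map (key i) (sort (fun x y => key i x <= key i y) ys)).
Proof.
move=> uys; rewrite lt_sorted_uniq_le (perm_uniq (s2 := map (key i) ys)) ?uys /=.
  by rewrite sorted_map sort_sorted // => x y /=; apply: le_total.
by apply: perm_map; rewrite perm_sort.
Qed.

Lemma perm_map_rank i ys : uniq (map (key i) ys) ->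
  perm_eq (map (rank i ys) ys) (iota 0 (size ys)).
Proof.
move=> uys; set zs := sort (fun x y => key i x <= key i y) ys.
have zys : perm_eq zs ys by rewrite perm_sort.
rewrite -(perm_size zys) -(sorted_map_rank (sort_key_sorted uys)) -/zs.
by rewrite (eq_map (fun x => perm_rank i x zys)) perm_sym perm_map.
Qed.

Lemma count_iota lo hi m : (lo <= hi <= m)%N ->
  count (fun r => lo <= r < hi)%N (iota 0 m) = (hi - lo)%N.
Proof.
move=> /andP[lohi him].
have -> : iota 0 m = iota 0 lo ++ iota lo (hi - lo) ++ iota hi (m - hi).
  have {1}-> : m = (lo + (hi - lo) + (m - hi))%N by lia.
  by rewrite !iotaD !add0n -catA subnKC.
rewrite !count_cat (@eq_in_count _ _ pred0 (iota 0 lo)); last first.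
  by move=> x; rewrite mem_iota /=; lia.
rewrite (@eq_in_count _ _ predT (iota lo (hi - lo))); last first.
  by move=> x; rewrite mem_iota /=; lia.
rewrite (@eq_in_count _ _ pred0 (iota hi _)); last first.
  by move=> x; rewrite mem_iota /=; lia.
by rewrite !count_pred0 count_predT size_iota addn0.
Qed.

Lemma count_rank_window i ys lo hi : uniq (map (key i) ys) ->
  (lo <= hi <= size ys)%N ->
  count (fun x => lo <= rank i ys x < hi)%N ys = (hi - lo)%N.
Proof.
move=> uys lohi.
rewrite -[LHS]/(count (preim (rank i ys) (fun r => lo <= r < hi)%N) ys).
by rewrite -count_map (seq.permP (perm_map_rank uys)) count_iota.
Qed.

Lemma filter_window (f : T -> nat) m lo hi ys :
  map f ys = iota m (size ys) ->
  [seq x <- ys | lo <= f x < hi]%N = drop (lo - m) (take (hi - m) ys).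
Proof.
elim: ys m => [|y ys IH] m //= [fy fys].
rewrite fy (IH m.+1) //; case: (leqP lo m) => lom; case: (ltnP m hi) => mhi /=.
- have -> : (hi - m = (hi - m.+1).+1)%N by lia.
  have -> : (lo - m = 0)%N by lia.
  have -> : (lo - m.+1 = 0)%N by lia.
  by rewrite !drop0.
- have -> : (hi - m = 0)%N by lia.
  have -> : (hi - m.+1 = 0)%N by lia.
  by rewrite !take0 !drop_oversize.
- have -> : (hi - m = (hi - m.+1).+1)%N by lia.
  by have -> : (lo - m = (lo - m.+1).+1)%N by lia.
- have -> : (hi - m = 0)%N by lia.
  have -> : (hi - m.+1 = 0)%N by lia.
  by rewrite !take0 !drop_oversize.
Qed.

(** Positions in a sorted sequence are traded for ranks: a rank condition, unlike a position, still
    makes sense for points outside the sample and after an insertion. *)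
Lemma perm_drop_take_sort i ys lo hi : uniq (map (key i) ys) ->
  perm_eq (drop lo (take hi (sort (fun x y => key i x <= key i y) ys)))
          [seq x <- ys | lo <= rank i ys x < hi]%N.
Proof.
move=> uys; set zs := sort _ _; have zys : perm_eq zs ys by rewrite perm_sort.
rewrite (eq_filter (a2 := fun x => lo <= rank i zs x < hi)%N); last first.
  by move=> x /=; rewrite (perm_rank i x zys).
rewrite perm_sym -(permPl (perm_filter _ zys)).
rewrite (filter_window (m := 0)) ?subn0 //.
by apply: sorted_map_rank; apply: sort_key_sorted.
Qed.

(** Without ties, the number of points in a region is determined by the sample size and the index
    and not by the data, so all cut ranks are deterministic. *)
Fixpoint npts n j i : nat :=
  if i is i'.+1 then
    let rk := cut_rank (p (take i' j)) (npts n j i') in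
    let s := nth 0%N j i' in (rk s.+1 - rk s)%N
  else n.

Definition rk n j i s := cut_rank (p (take i j)) (npts n j i) s.

Lemma leq_rk n j i s t : (s <= t)%N -> (rk n j i s <= rk n j i t)%N.
Proof. by move=> st; apply: leq_div2r; rewrite leq_mul2l st orbT. Qed.

Lemma rk_last n j i : rk n j i (p (take i j)).+1 = npts n j i.
Proof. by rewrite /rk /cut_rank mulnK. Qed.

(* [cell n a] contains the configuration of [n + a] points obtained by
   inserting [a] new points into a sample of size [n], all of them inside the
   region of index [j]: the upper cut ranks are shifted by [a]. *)
Fixpoint cell n a j xs i : seq T :=
  if i is i'.+1 then
    let ys := cell n a j xs i' in
    let s := nth 0%N j i' in
    [seq x <- ys | rk n j i' s <= rank i' ys x < rk n j i' s.+1 + a]%N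
  else xs.

(* The point of largest rank in a cell is the upper endpoint of the cell, hence
   not a new point, unless the cell is the last one of its level. *)
Fixpoint elig n a j xs i : seq T :=
  if i is i'.+1 then
    let s := nth 0%N j i' in
    [seq x <- elig n a j xs i' | rk n j i' s <= rank i' (cell n a j xs i') x
       < rk n j i' s.+1 + a - (s < p (take i' j))]%N
  else xs.

Definition no_ties l xs := forall i, (i < l)%N -> uniq (map (key i) xs).
Definition valid_index l j := forall i, (i < l)%N ->
  (nth 0%N j i <= p (take i j))%N.

Lemma cell_subseq n a j xs i : subseq (cell n a j xs i) xs.
Proof. by elim: i => //= i IH; apply: subseq_trans (filter_subseq _ _) IH. Qed.

Lemma elig_subseq n a j xs i : subseq (elig n a j xs i) (cell n a j xs i).
Proof.
elim: i => //= i IH; set P := (X in subseq (seq.filter X _) _).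
set Q := (X in subseq _ (seq.filter X _)).
have PQ x : P x -> Q x.
  by rewrite /P /Q => /andP[-> /leq_trans]; apply; rewrite leq_subr.
rewrite subseq_filter (subseq_trans (filter_subseq _ _) IH) andbT.
by apply/allP => x; rewrite mem_filter => /andP[/PQ].
Qed.

Lemma uniq_cell l n a j xs i : no_ties l xs -> (i < l)%N ->
  uniq (map (key i) (cell n a j xs i)).
Proof.
by move=> nt il; apply: subseq_uniq (nt _ il); apply/map_subseq/cell_subseq.
Qed.

Lemma size_cell l n a j xs i : no_ties l xs -> valid_index l j ->
  size xs = (n + a)%N -> (i <= l)%N -> size (cell n a j xs i) = (npts n j i + a)%N.
Proof.
move=> nt vj sxs; elim: i => //= i IH il.
rewrite size_filter count_rank_window; first last.
- rewrite IH ?(ltnW il) // leq_add2r -rk_last leq_rk ?ltnS ?vj // andbT.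
  by rewrite (leq_trans (leq_rk _ _ _ (leqnSn _))) ?leq_addr.
- exact: uniq_cell nt il.
- have := leq_rk n j i (leqnSn (nth 0%N j i)).
  by rewrite -/(rk n j i _) -/(rk n j i _); lia.
Qed.

(** Here [W] consists of new points lying in the region built from the old sample [D]. An old point
    of rank below the lower cut has no new point below it and keeps its rank; one of rank at or
    above the upper cut has all [a] new points below it and moves up by [a]. So the shifted window
    recovers the old cell together with [W] from [F] alone. *)
Lemma cell_insert l n a j F W D :
  no_ties l F -> valid_index l j -> perm_eq F (W ++ D) ->
  size W = a -> size D = n ->
  (forall w i, w \in W -> (i < l)%N ->
     (rk n j i (nth 0%N j i) <= rank i (cell n 0 j D i) w)%N /\
     ((nth 0%N j i < p (take i j))%N ->
        (rank i (cell n 0 j D i) w < rk n j i (nth 0%N j i).+1)%N)) ->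
  forall i, (i <= l)%N -> perm_eq (cell n a j F i) (W ++ cell n 0 j D i) /\
    {subset W <= elig n a j F i}.
Proof.
move=> ntF vj FWD sW sD hW; elim => [_|i IH il].
  by split=> // x xW; rewrite /= (perm_mem FWD) mem_cat xW.
have {IH} [IH1 IH2] := IH (ltnW il).
have ntD : no_ties l D.
  move=> i' i'l; have := ntF _ i'l.
  rewrite (perm_uniq (perm_map _ FWD)) map_cat.
  by apply: subseq_uniq; apply: suffix_subseq.
have := size_cell ntD vj (n := n) (a := 0) _ (ltnW il).
rewrite addn0 => /(_ sD); rewrite addn0 => sC.
set C := cell n 0 j D i in IH1 sC hW *; set Y := cell n a j F i in IH1 *.
set s := nth 0%N j i.
have rkY x : rank i Y x = (rank i W x + rank i C x)%N.
  by rewrite (perm_rank _ _ IH1) /rank count_cat.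
have sp : (s <= p (take i j))%N by apply: vj.
(* Of the points below [w], at most [a - 1] are new and, unless the cell is the last one, fewer than
   [rk n j i s.+1] are old; hence [w] misses the top rank of the window. *)
have hw w : w \in W -> (rk n j i s <= rank i Y w < rk n j i s.+1 + a - (s < p (take i j)))%N.
  move=> wW; have [h1 h2] := hW w i wW il; rewrite rkY.
  have := rank_lt_size i wW; rewrite sW => h3.
  rewrite -/s -/C in h1 h2.
  case: ltngtP sp h2 => // [sp _ /(_ isT) h2|sp _ _].
    by rewrite (leq_trans h1) ?leq_addl //=; lia.
  have : (rank i C w <= npts n j i)%N by rewrite -sC count_size.
  rewrite sp rk_last (leq_trans _ (leq_addl _ _)) -?sp //=; lia.
split; last first.
  by move=> w wW /=; rewrite mem_filter -/Y -/s hw // IH2.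
rewrite /= -/Y -/C -/s.
rewrite (permPl (perm_filter _ IH1)) filter_cat.
rewrite (_ : seq.filter _ W = W); last first.
  apply/all_filterP/allP => w /hw /andP[-> /leq_trans]; apply.
  by rewrite leq_subr.
apply: perm_cat => //; rewrite (eq_in_filter (a2 := fun x =>
   (rk n j i s <= rank i C x < rk n j i s.+1 + 0)%N)) // => x xC.
rewrite rkY addn0; have xs := rank_lt_size i xC.
have Wa : (rank i W x <= a)%N by rewrite -sW count_size.
case: (ltnP (rank i C x) (rk n j i s)) => h1 /=.
  suff -> : rank i W x = 0%N by rewrite add0n leqNgt h1.
  apply/eqP; rewrite -leqn0 leqNgt -has_count; apply/hasPn => w wW.
  rewrite -leNgt leNgt; apply/negP => /ltW /(rank_mono C).
  have [/leq_trans h _] := hW w i wW il.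
  by move=> /h; rewrite leqNgt h1.
rewrite (leq_trans h1 (leq_addl _ _)) /=.
case: (ltnP (rank i C x) (rk n j i s.+1)) => h2; first lia.
(* In the last cell the upper cut is the full size of the parent cell, which the rank of an old
   point cannot reach. *)
have sq : (s < p (take i j))%N.
  by rewrite ltn_neqAle sp andbT; apply/eqP => sq; move: h2; rewrite sq rk_last; lia.
suff -> : rank i W x = a by lia.
rewrite -sW; apply/eqP; rewrite -all_count; apply/allP => w wW /=.
rewrite ltNge; apply/negP => /(rank_mono C) h3.
have [_ /(_ sq)] := hW w i wW il; rewrite -/s -/C.
by rewrite ltnNge (leq_trans h2 h3).
Qed.

Lemma uniq_rank_elig l n a j xs i : no_ties l xs -> (i < l)%N ->
  uniq (map (rank i (cell n a j xs i)) (elig n a j xs i)).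
Proof.
move=> nt il; apply: subseq_uniq (map_subseq _ (elig_subseq _ _ _ _ _)) _.
by rewrite (perm_uniq (perm_map_rank (uniq_cell _ _ _ nt il))) iota_uniq.
Qed.

Lemma count_window_le (f : T -> nat) ys lo m : uniq (map f ys) ->
  (count (fun x => lo <= f x < lo + m)%N ys <= m)%N.
Proof.
move=> uf; rewrite -[X in (X <= _)%N]/(count (preim f (fun r => lo <= r < lo + m)%N) ys).
rewrite -count_map -size_filter -[leqRHS](size_iota lo); apply: uniq_leq_size.
  exact: filter_uniq.
by move=> r; rewrite mem_filter mem_iota => /andP[].
Qed.

(** A level discards at most its top rank, and ranks are distinct, so at most one point is lost per
    level. *)
Lemma size_cell_elig l n a j xs i : no_ties l xs -> (i <= l)%N ->
  (size (cell n a j xs i) <= size (elig n a j xs i) + i)%N.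
Proof.
move=> nt; elim: i => [|i IH] il; first by rewrite addn0.
have {}IH := IH (ltnW il).
have us := uniq_rank_elig n a j nt il; rewrite /= !size_filter.
set s := nth 0%N j i; set C := cell n a j xs i in IH us *.
set E := elig n a j xs i in IH us *.
set P := fun x => _; set P' := (X in (_ <= count X _ + _)%N).
have CE : (count (predC P) E <= count (predC P) C)%N.
  exact/leq_count_subseq/elig_subseq.
have EP : (count P E <= count P' E + 1)%N.
  set top := (rk n j i s.+1 + a - 1)%N.
  apply: leq_trans (leq_add (leqnn _) (count_window_le top 1 us)).
  rewrite -count_predUI (leq_trans _ (leq_addr _ _)) //; apply: sub_count => x /=.
  by rewrite /P /P' /top -/s -/C; case: (s < _)%N; lia.
have := count_predC P C; have := count_predC P E; lia.
Qed.

(* Consecutive windows of ranks share [a.-1] ranks once the top one is removed. *)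
Lemma sum_windows_le (f : T -> nat) ys (c : nat -> nat) q a : uniq (map f ys) ->
  {homo c : s t / (s <= t)%N} ->
  (\sum_(s <- iota 0 q.+1) count (fun x => c s <= f x < c s.+1 + a - (s < q))%N ys
    <= size ys + a.-1 * q)%N.
Proof.
move=> uf cm; rewrite -[q.+1]addn1 iotaD big_cat /= big_seq1 add0n ltnn subn0.
have : (\sum_(s <- iota 0 q) count (fun x => c s <= f x < c s.+1 + a - (s < q))%N ys
    <= count (fun x => f x < c q)%N ys + a.-1 * q)%N.
  rewrite big_seq_cond.
  under eq_bigr => s do [rewrite andbT mem_iota add0n => /= sq; rewrite sq].
  rewrite -big_seq_cond; elim: q => [|q IH].
    by rewrite big_nil.
  rewrite -[q.+1]addn1 iotaD big_cat /= big_seq1 add0n.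
  apply: leq_trans (leq_add IH (leqnn _)) _.
  rewrite addn1 mulnS addnAC [leqRHS]addnA leq_add2r.
  apply: (@leq_trans (count (fun x => f x < c q)%N ys
      + (count (fun x => c q <= f x < c q.+1)%N ys + a.-1))%N).
    rewrite leq_add2l.
    apply: leq_trans (leq_add (leqnn _) (count_window_le (c q.+1) a.-1 uf)).
    rewrite -count_predUI (leq_trans _ (leq_addr _ _)) //; apply: sub_count => x /=.
    by have := cm _ _ (leqnSn q); lia.
  rewrite addnA leq_add2r -count_predUI.
  rewrite (eq_count (a1 := predI _ _) (a2 := pred0)); last by move=> x /=; lia.
  rewrite count_pred0 addn0; apply: sub_count => x /=.
  by have := cm _ _ (leqnSn q); lia.
move=> h; apply: leq_trans (leq_add h (leqnn _)) _.
rewrite addnAC leq_add2r -(count_predC (fun x => f x < c q)%N) leq_add2l.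
by apply: sub_count => x /=; lia.
Qed.

Lemma indices_size i j : j \in indices p i -> size j = i.
Proof.
elim: i j => [|i IH] j; first by rewrite inE => /eqP ->.
by move=> /allpairsPdep[j' [s [/IH <- _ ->]]]; rewrite size_rcons.
Qed.

Lemma indices_valid i j : j \in indices p i -> valid_index i j.
Proof.
elim: i j => [|i IH] j; first by move=> _ m.
move=> /allpairsPdep[j' [s [j'i sp ->]]] m.
have sj' := indices_size j'i.
rewrite ltnS leq_eqVlt nth_rcons => /orP[/eqP ->|mi].
  rewrite sj' ltnn eqxx -cats1 take_cat sj' ltnn subnn take0 cats0.
  by move: sp; rewrite mem_iota add0n ltnS.
by rewrite sj' mi -cats1 takel_cat ?sj' ?(ltnW mi) //; apply: IH.
Qed.

Lemma npts_prefix n j j' i : (i <= size j)%N -> npts n (j ++ j') i = npts n j i.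
Proof.
elim: i => //= i IH ij; rewrite IH ?(ltnW ij) // takel_cat ?(ltnW ij) //.
by rewrite nth_cat ij.
Qed.

Lemma rk_prefix n j j' i s : (i <= size j)%N -> rk n (j ++ j') i s = rk n j i s.
Proof. by move=> ij; rewrite /rk npts_prefix // takel_cat. Qed.

Lemma cell_prefix n a j j' xs i : (i <= size j)%N ->
  cell n a (j ++ j') xs i = cell n a j xs i.
Proof.
elim: i => //= i IH ij; rewrite IH ?(ltnW ij) // nth_cat ij.
by apply: eq_filter => x; rewrite !rk_prefix // ltnW.
Qed.

Lemma elig_prefix n a j j' xs i : (i <= size j)%N ->
  elig n a (j ++ j') xs i = elig n a j xs i.
Proof.
elim: i => //= i IH ij; rewrite IH ?(ltnW ij) // nth_cat ij.
by apply: eq_filter => x; rewrite !rk_prefix ?cell_prefix ?takel_cat // ltnW.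
Qed.

(** Cutting a region into [q + 1] pieces repeats at most [a.-1 * q] points, and over all cuts these
    [q] add up to the number of regions minus one. The [a.-1] on the left stands for that minus one
    and keeps truncated subtraction out of the induction. *)
Lemma sum_size_elig l n a xs i : no_ties l xs -> (i <= l)%N ->
  (\sum_(j <- indices p i) size (elig n a j xs i) + a.-1 <=
   size xs + a.-1 * size (indices p i))%N.
Proof.
move=> nt; elim: i => [|i IH] il; first by rewrite /= big_seq1 muln1.
have {}IH := IH (ltnW il).
rewrite (_ : indices p i.+1 =
  [seq rcons j s | j <- indices p i, s <- iota 0 (p j).+1]) // big_allpairs_dep size_allpairs_dep.
under [X in (_ <= _ + _ * sumn X)%N]eq_map => j do rewrite size_iota.
rewrite sumnE big_map.
apply: (@leq_trans (\sum_(j <- indices p i)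
   (size (elig n a j xs i) + a.-1 * p j) + a.-1)).
  rewrite leq_add2r big_seq [leqRHS]big_seq; apply: leq_sum => j ji.
  have sj := indices_size ji.
  apply: leq_trans (sum_windows_le (p j) a (uniq_rank_elig n a j nt il)
    (c := rk n j i) _).
    apply: leq_sum => s _; rewrite /= size_filter -cats1.
    rewrite cell_prefix ?elig_prefix ?sj // takel_cat ?sj // (_ : take i j = j);
      last by rewrite -sj take_size.
    rewrite nth_cat sj ltnn subnn /= !rk_prefix ?sj //.
  by move=> s t; apply: leq_rk.
rewrite big_split /= -big_distrr /= addnAC.
apply: leq_trans (leq_add IH (leqnn _)) _.
rewrite -addnA leq_add2l -mulnDr leq_mul2l; apply/orP; right.
by rewrite -sum1_size -big_split /=; apply: leq_sum => j _; rewrite add1n.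
Qed.

End RankCells.

(** * Regions of the sample space in terms of ranks *)

Section RegionRanks.
Variables (R : realType) (k : nat) (a b : k.-tuple (\bar R)).
Variable p : seq nat -> nat.
Implicit Types (xs : seq (k.-tuple R)) (j : seq nat).

Definition coord i (x : k.-tuple R) : R := x`_i.

Lemma assigned_cell l n j xs i : no_ties coord l xs -> valid_index p l j ->
  size xs = n -> (i <= l)%N ->
  perm_eq (assigned p xs j i) (cell coord p n 0 j xs i).
Proof.
move=> nt vj sxs; elim: i => // i IH il.
have {}IH := IH (ltnW il).
have := size_cell nt vj (n := n) (a := 0) _ (ltnW il).
rewrite addn0 => /(_ sxs); rewrite addn0 => sC.
have sA : size (assigned p xs j i) = npts p n j i by rewrite (perm_size IH).
rewrite /= sA.
apply: perm_trans (perm_drop_take_sort (key := coord) (i := i) _ _ _) _.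
  by rewrite (perm_uniq (perm_map _ IH)) (uniq_cell _ _ _ _ nt).
rewrite (permPl (perm_filter _ IH)); apply/seq.permP => Q; congr (count Q _).
by apply: eq_filter => x; rewrite (perm_rank _ _ _ IH) addn0.
Qed.

(** An order statistic of rank [r >= 1] lies strictly below a value exactly when at least [r] points
    do. The condition [p (take i j) < npts p n j i] makes the inner cut ranks positive, so the
    predecessor taken in [cutpoint] does not truncate. *)
Lemma cutpoint_lt l n j xs i s (x : k.-tuple R) : no_ties coord l xs -> valid_index p l j ->
  size xs = n -> (i < l)%N -> (0 < s <= p (take i j))%N ->
  (p (take i j) < npts p n j i)%N ->
  (cutpoint a b p xs j i s < (x`_i)%:E)%E =
    (rk p n j i s <= rank coord i (cell coord p n 0 j xs i) x)%N.
Proof.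
move=> nt vj sxs il /andP[s0 sp] pn.
have IH := assigned_cell nt vj sxs (ltnW il).
have := size_cell nt vj (n := n) (a := 0) _ (ltnW il).
rewrite addn0 => /(_ sxs); rewrite addn0 => sC.
have sA : size (assigned p xs j i) = npts p n j i by rewrite (perm_size IH).
rewrite /cutpoint gtn_eqF // ltn_eqF // sA -/(rk p n j i s).
rewrite -(perm_rank _ _ _ IH) lte_fin /rank.
set ys := assigned p xs j i; set vs := [seq _ | x <- ys].
have rk0 : (0 < rk p n j i s)%N.
  by rewrite /rk /cut_rank divn_gt0 //; apply: leq_trans pn (leq_pmulr _ _).
have rkn : (rk p n j i s <= npts p n j i)%N.
  by rewrite -(rk_last p n j i) leq_rk // leqW.
rewrite -[X in (_ <= X)%N]/(count (preim (coord i) (< coord i x)) ys) -count_map.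
rewrite -[map (coord i) ys]/vs -(seq.permP (permEl (perm_sort <=%O vs))).
have svs : sorted <=%O (sort <=%O vs) by apply: sort_sorted; apply: le_total.
have szvs : size (sort <=%O vs) = npts p n j i by rewrite size_sort size_map.
rewrite -(prednK rk0); apply/idP/idP => h; last exact: nth_count_lt.
rewrite ltnNge; apply/negP => h'; move: h; rewrite ltNge => /negP; apply.
by apply: nth_count_ge => //; apply/andP; split; rewrite ?szvs ?prednK.
Qed.

(** This supplies the premise on new points in [cell_insert]. Intervals open below and closed above
    give a weak lower and a strict upper bound on the rank. *)
Lemma region_rank l n j xs (x : k.-tuple R) : no_ties coord l xs -> valid_index p l j ->
  size j = l -> size xs = n -> (forall i, (i < l)%N -> (p (take i j) < npts p n j i)%N) ->
  region a b p xs j x -> forall i, (i < l)%N ->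
  (rk p n j i (nth 0%N j i) <= rank coord i (cell coord p n 0 j xs i) x)%N /\
  ((nth 0%N j i < p (take i j))%N ->
     (rank coord i (cell coord p n 0 j xs i) x < rk p n j i (nth 0%N j i).+1)%N).
Proof.
move=> nt vj sj sxs pn [_ rx] i il; rewrite sj in rx.
have {rx} /andP[lo hi] := rx i il; split.
  case: (posnP (nth 0%N j i)) => [->|s0]; first by rewrite /rk /cut_rank muln0 div0n.
  by rewrite -(cutpoint_lt x nt vj sxs il _ (pn _ il)) // s0 vj.
move=> sp; rewrite ltnNge -(cutpoint_lt x nt vj sxs il _ (pn _ il)) //.
by rewrite -leNgt.
Qed.

End RegionRanks.

(** * Nominal probabilities and the sizes of the cells *)

Section Nominal.
Variables (R : realType) (p : seq nat -> nat).
Implicit Types (j : seq nat).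

Definition share i j : R := (\prod_(m < i) (p (take m j)).+1)%N%:R^-1.

Lemma share_size j : nominal R p j = share (size j) j. Proof. by []. Qed.

Lemma shareS i j : share i.+1 j = share i j / (p (take i j)).+1%:R.
Proof. by rewrite /share big_ord_recr /= natrM invfM. Qed.

Lemma share_gt0 i j : 0 < share i j.
Proof. by rewrite invr_gt0 ltr0n; apply: prodn_gt0. Qed.

Lemma share_le i i' j : (i <= i')%N -> share i' j <= share i j.
Proof.
move=> /subnK <-; elim: (_ - _)%N => // m IH; apply: le_trans IH.
by rewrite addSn shareS ler_pdivrMr ?ltr0n // ler_peMr ?ler1n // ltW // share_gt0.
Qed.

Lemma share_prefix i j j' : (i <= size j)%N -> share i (j ++ j') = share i j.
Proof.
move=> ij; rewrite /share; congr (_%:R^-1); apply: eq_bigr => m _.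
by rewrite takel_cat // (leq_trans (ltnW (ltn_ord m))).
Qed.

Lemma sum_share i : \sum_(j <- indices p i) share i j = 1.
Proof.
elim: i => [|i IH]; first by rewrite big_seq1 /share big_ord0 invr1.
rewrite (_ : indices p i.+1 =
  [seq rcons j s | j <- indices p i, s <- iota 0 (p j).+1]) // big_allpairs_dep /=.
rewrite -[RHS]IH big_seq [RHS]big_seq; apply: eq_bigr => j ji.
have sj := indices_size ji.
transitivity (\sum_(s <- iota 0 (p j).+1) (share i j / (p j).+1%:R)).
  apply: eq_bigr => s _; rewrite -cats1 shareS share_prefix ?sj // takel_cat ?sj //.
  by rewrite -{2}sj take_size.
rewrite big_const_seq count_predT size_iota iter_addr_0 -[_ *+ _]mulr_natr.
by rewrite divfK // pnatr_eq0.
Qed.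

Lemma cut_rank_bounds q n s :
  (n * s)%:R / q.+1%:R - 1 < (cut_rank q n s)%:R :> R /\
  (cut_rank q n s)%:R <= (n * s)%:R / q.+1%:R :> R.
Proof.
have q0 : 0 < q.+1%:R :> R by rewrite ltr0n.
rewrite /cut_rank; split.
  rewrite ltrBlDr ltr_pdivrMr // natr1 -natrM ltr_nat.
  exact: ltn_ceil.
by rewrite ler_pdivlMr // -natrM ler_nat leq_divM.
Qed.

(** The difference of two floors is within one of the exact increment, and the error inherited from
    the previous level is only divided by [q + 1]; so each level adds at most one. *)
Lemma npts_share n j i : `|(npts p n j i)%:R - n%:R * share i j| <= i%:R :> R.
Proof.
elim: i => [|i IH]; first by rewrite /= /share big_ord0 invr1 mulr1 subrr normr0.
rewrite [npts _ _ _ _]/= natrB; last exact: (leq_rk p n j i (leqnSn _)).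
set N := npts p n j i in IH *; set q := p (take i j); set s := nth 0%N j i.
have q0 : 0 < q.+1%:R :> R by rewrite ltr0n.
have [h1 h2] := cut_rank_bounds q N s.+1; have [h3 h4] := cut_rank_bounds q N s.
have e1 : (N * s.+1)%:R / q.+1%:R - (N * s)%:R / q.+1%:R = N%:R / q.+1%:R :> R.
  by rewrite -mulrBl !natrM -mulrBr -natrB // subSnn mulr1.
have e2 : `|N%:R / q.+1%:R - n%:R * share i.+1 j| <= i%:R.
  rewrite shareS -/q mulrA -mulrBl normf_div (ger0_norm (ltW q0)).
  by rewrite ler_pdivrMr // (le_trans IH) // ler_peMr ?ler1n.
have i1 : i.+1%:R = i%:R + 1 :> R by rewrite natr1.
move: e2; rewrite !ler_norml i1 => /andP[e2 e3]; apply/andP.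
move: (cut_rank _ _ s.+1)%:R (cut_rank _ _ s)%:R h1 h2 h3 h4 e2 e3 e1.
move: (_ / _ : R) (_ / _ : R) (_ / _ : R) (n%:R * _) => A B C D x y.
by split; lra.
Qed.

End Nominal.

(** * Exchangeability of i.i.d. points *)

Section TupleLaws.
Context d (T : measurableType d) (R : realType).

Definition rect n (B : 'I_n -> set T) : set (n.-tuple T) :=
  [set x | forall i, B i (tnth x i)].


Lemma measurable_rect n (B : 'I_n -> set T) :
  (forall i, measurable (B i)) -> measurable (rect B).
Proof.
move=> mB; rewrite (_ : rect B = \big[setI/setT]_(i < n) ((@tnth n T)^~ i @^-1` B i)).
  apply: bigsetI_measurable => i _; rewrite -[X in measurable X]setTI.
  exact: measurable_tnth.
rewrite -bigcap_seq; apply/seteqP; split => x /= h.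
  by move=> i _; apply: h.
by move=> i; apply: h; rewrite /= mem_index_enum.
Qed.

Lemma eq_rect_measure n (P Q : probability (n.-tuple T) R) :
  (forall B : 'I_n -> set T, (forall i, measurable (B i)) -> P (rect B) = Q (rect B)) ->
  forall A, measurable A -> P A = Q A.
Proof.
move=> PQ A mA.
pose G := [set C | exists B : 'I_n -> set T, (forall i, measurable (B i)) /\ C = rect B].
have rT : @setT (n.-tuple T) = rect (fun _ : 'I_n => setT) by apply/seteqP; split.
apply: (@measure_unique _ _ _ G (fun=> setT)) => //.
- apply/seteqP; split; last first.
    apply: smallest_sub; first exact: sigma_algebra_measurable.
    by move=> _ [B [mB ->]]; apply: measurable_rect.
  apply: smallest_sub; first exact: smallest_sigma_algebra.
  rewrite -bigcup_seq => _ [i _ [C mC <-]]; apply: sub_sigma_algebra.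
  exists (fun m => if m == i then C else setT); split; first by move=> m; case: ifP.
  apply/seteqP; split => x /=.
    by move=> [_ Cx] m; case: eqP => // ->.
  by move=> /(_ i); rewrite eqxx.
- move=> _ _ [B [mB ->]] [C [mC ->]]; exists (fun i => B i `&` C i); split.
    by move=> i; apply: measurableI.
  by apply/seteqP; split => x /=; [move=> [h h'] i; split|
    move=> h; split => i; have [] := h i].
- by move=> _; exists (fun=> setT); split.
- by rewrite bigcup_const.
- by move=> _ [B [mB ->]]; apply: PQ.
- by move=> m; apply: le_lt_trans (probability_le1 P measurableT) (ltry 1).
Qed.

Definition tuple_cons n (z : T * n.-tuple T) : n.+1.-tuple T := [tuple of z.1 :: z.2].

Lemma measurable_tuple_cons n : measurable_fun setT (@tuple_cons n).
Proof. exact: measurable_cons. Qed.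

HB.instance Definition _ n :=
  isMeasurableFun.Build _ _ _ _ (@tuple_cons n) (@measurable_tuple_cons n).

Variable mu : probability T R.

(** The recursion on the number of points lets Tonelli's theorem split off one point at a time. *)
Fixpoint iid_law n : probability (n.-tuple T) R :=
  if n is n'.+1 then distribution (mu \x iid_law n')%E (@tuple_cons n')
  else dirac [tuple].

Lemma iid_law_rect n (B : 'I_n -> set T) : (forall i, measurable (B i)) ->
  iid_law n (rect B) = (\prod_(i < n) mu (B i))%E.
Proof.
elim: n B => [|n IH] B mB.
  by rewrite big_ord0 /= diracE mem_set // => -[].
rewrite big_ord_recl -IH; last by move=> i; apply: mB.
rewrite -product_measure1E //; last exact: measurable_rect.
rewrite [LHS]/=; congr (_ _); apply/seteqP; split => -[x y] /=.
  move=> h; split; first exact: (h ord0).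
  by move=> i; have := h (lift ord0 i); rewrite tnthS.
move=> [h0 h] i; case: (unliftP ord0 i) => [m ->|->] //.
by have := h m; rewrite tnthS.
Qed.

Lemma iid_law_unique n (P : probability (n.-tuple T) R) :
  (forall B : 'I_n -> set T, (forall i, measurable (B i)) ->
     P (rect B) = (\prod_(i < n) mu (B i))%E) ->
  forall A, measurable A -> P A = iid_law n A.
Proof. by move=> h; apply: eq_rect_measure => B mB; rewrite h // iid_law_rect. Qed.

Definition tuple_perm n (s : 'S_n) (x : n.-tuple T) := [tuple tnth x (s i) | i < n].

Lemma measurable_tuple_perm n (s : 'S_n) : measurable_fun setT (tuple_perm s).
Proof.
apply/measurable_fun_tnthP => i; rewrite (_ : _ \o _ = (@tnth n T)^~ (s i)).
  exact: measurable_tnth.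
by apply/funext => x /=; rewrite tnth_mktuple.
Qed.

HB.instance Definition _ n (s : 'S_n) :=
  isMeasurableFun.Build _ _ _ _ (tuple_perm s) (measurable_tuple_perm s).

Lemma iid_law_perm n (s : 'S_n) (h : n.-tuple T -> \bar R) :
  measurable_fun [set: n.-tuple T] h -> (forall x, 0 <= h x)%E ->
  (\int[iid_law n]_x h (tuple_perm s x) = \int[iid_law n]_x h x)%E.
Proof.
move=> mh h0; rewrite -[LHS](ge0_integral_distribution (tuple_perm s)) //.
apply: eq_measure_integral => A mA _; apply: iid_law_unique => // B mB.
rewrite -[LHS]/(iid_law n (tuple_perm s @^-1` rect B)).
rewrite (_ : _ @^-1` _ = rect (fun i => B ((s^-1)%g i))).
  rewrite iid_law_rect // (reindex_inj (@perm_inj _ s)) /=.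
  by apply: eq_bigr => i _; rewrite permK.
apply/seteqP; split => x /= hx i.
  by have := hx ((s^-1)%g i); rewrite tnth_mktuple permKV.
by have := hx (s i); rewrite tnth_mktuple permK.
Qed.

Lemma iid_law_tnth n (i : 'I_n) A : measurable A ->
  iid_law n ((@tnth n T)^~ i @^-1` A) = mu A.
Proof.
move=> mA.
rewrite (_ : _ @^-1` _ = rect (fun m => if m == i then A else setT)).
  rewrite iid_law_rect; last by move=> m; case: ifP.
  rewrite (bigD1 i) //= eqxx big1 ?mule1 // => m /negPf ->.
  exact: probability_setT.
apply/seteqP; split => x /= h; last by have := h i; rewrite eqxx.
by move=> m; case: eqP => // ->.
Qed.

End TupleLaws.

(** The symmetric group is [m]-transitive. This brings any ordered choice of [m] distinct positions
    to the front. *)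
Lemma perm_extends (T : finType) m (f g : 'I_m -> T) :
  injective f -> injective g -> exists s : {perm T}, forall i, s (g i) = f i.
Proof.
move=> injf injg.
have mT : (m <= #|T|)%N by rewrite -[m]card_ord (leq_card f).
have tr := ntransitive_weak mT (Sym_trans T).
have dt (h : 'I_m -> T) : injective h -> [tuple h i | i < m] \in dtuple_on m (finset.setTfor T).
  by move=> injh; apply/dtuple_onP; split=> [i j|i]; rewrite ?inE // !tnth_mktuple => /injh.
have := atransP2 tr (dt _ injg) (dt _ injf) => -[s _ st]; exists s => i.
by move: st => /(congr1 (fun t => tnth t i)); rewrite [RHS]tnth_map !tnth_mktuple => ->.
Qed.

Section Exchange.
Context d (T : measurableType d) (R : realType).
Variable mu : probability T R.

Definition back a n (y : (a + n).-tuple T) : n.-tuple T :=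
  [tuple tnth y (rshift a i) | i < n].

Lemma measurable_back a n : measurable_fun setT (@back a n).
Proof.
apply/measurable_fun_tnthP => i; rewrite (_ : _ \o _ = (@tnth _ T)^~ (rshift a i)).
  exact: measurable_tnth.
by apply/funext => x /=; rewrite tnth_mktuple.
Qed.

Definition sectionr n (A : set (n.-tuple T * T)) (x : n.-tuple T) : R :=
  fine (mu (xsection A x)).

Lemma measurable_sectionr n (A : set (n.-tuple T * T)) :
  measurable A -> measurable_fun setT (sectionr A).
Proof.
move=> mA; apply: measurableT_comp; first exact: fine_measurable.
exact: measurable_fun_xsection.
Qed.

Lemma sectionr_ge0 n (A : set (n.-tuple T * T)) x : 0 <= sectionr A x.
Proof. exact/fine_ge0/measure_ge0. Qed.

Definition front_in a n (A : set (n.-tuple T * T)) (y : (a + n).-tuple T) : R :=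
  \prod_(i < a) \1_A (back y, tnth y (lshift n i)).

Lemma measurable_front_in a n (A : set (n.-tuple T * T)) :
  measurable A -> measurable_fun setT (@front_in a n A).
Proof.
move=> mA; apply: measurable_prod => i _.
apply: measurableT_comp; first exact: measurable_indic.
apply: measurable_fun_pair; first exact: measurable_back.
exact: measurable_tnth.
Qed.

Lemma front_in_ge0 a n (A : set (n.-tuple T * T)) (y : (a + n).-tuple T) :
  0 <= front_in A y.
Proof. by apply: prodr_ge0 => i _; rewrite indicE. Qed.

Lemma back_cons a n (z : T * (a + n).-tuple T) :
  @back a.+1 n (tuple_cons z) = back z.2.
Proof. by apply: eq_from_tnth => i; rewrite !tnth_mktuple !(tnth_nth z.1). Qed.

Lemma front_in_cons a n (A : set (n.-tuple T * T)) (z : T * (a + n).-tuple T) :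
  @front_in a.+1 n A (tuple_cons z) = \1_A (back z.2, z.1) * front_in A z.2.
Proof.
rewrite /front_in big_ord_recl back_cons; congr (_ * _).
apply: eq_bigr => i _; congr (\1_A (_, _)).
by rewrite !(tnth_nth z.1).
Qed.

(* [front_in A y] tells whether the first [a] points of [y] lie in the region built
   from the remaining [n], so this is the moment of order [a] of its mass. *)
Lemma integral_front_in a n (A : set (n.-tuple T * T)) (h : n.-tuple T -> R) :
  measurable A -> measurable_fun [set: n.-tuple T] h -> (forall x, 0 <= h x) ->
  (\int[iid_law mu (a + n)]_y (h (back y) * front_in A y)%:E =
   \int[iid_law mu n]_x (h x * sectionr A x ^+ a)%:E)%E.
Proof.
move=> mA; elim: a h => [|a IH] h mh h0.
  apply: eq_integral => y _; rewrite /front_in big_ord0 expr0 !mulr1.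
  by congr (h _)%:E; apply: eq_from_tnth => i; rewrite tnth_mktuple; congr tnth; apply: val_inj.
have mf : measurable_fun setT (fun y : (a.+1 + n).-tuple T => (h (back y) * front_in A y)%:E).
  apply/measurable_EFinP/measurable_funM; last exact: measurable_front_in.
  by apply: (measurableT_comp mh); apply: measurable_back.
rewrite [LHS](ge0_integral_distribution _ mf); last first.
  by move=> y; rewrite lee_fin mulr_ge0 ?front_in_ge0.
transitivity (\int[mu \x iid_law mu (a + n)]_z
    (h (back z.2) * (\1_A (back z.2, z.1) * front_in A z.2))%:E)%E.
  apply: eq_integral => z _.
  exact: (congr2 (fun u v => (h u * v)%:E) (back_cons z) (front_in_cons A z)).
have mAb : measurable_fun [set: T * (a + n).-tuple T] (fun z => \1_A (back z.2, z.1) : R).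
  apply: measurableT_comp; first exact: measurable_indic.
  apply: measurable_fun_pair => //.
  by apply: (measurableT_comp (@measurable_back a n)).
rewrite fubini_tonelli2; first last.
- by move=> z; rewrite lee_fin mulr_ge0 ?mulr_ge0 ?front_in_ge0 // indicE.
- apply/measurable_EFinP/measurable_funM.
    apply: (measurableT_comp mh).
    by apply: (measurableT_comp (@measurable_back a n)).
  apply: measurable_funM => //.
  by apply: (measurableT_comp (measurable_front_in mA)).
transitivity (\int[iid_law mu (a + n)]_y
    ((h (back y) * sectionr A (back y)) * front_in A y)%:E)%E.
  apply: eq_integral => y _; rewrite /fubini_G /=.
  transitivity (\int[mu]_w ((h (back y) * front_in A y)%:E *
      (\1_(xsection A (back y)) w)%:E))%E.
    apply: eq_integral => w _; rewrite -EFinM mulrCA mulrC; congr (_ * _)%:E.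
    by rewrite !indicE mem_xsection.
  rewrite ge0_integralZl_EFin //; last first.
  - by rewrite mulr_ge0 ?front_in_ge0.
  - exact/measurable_EFinP/measurable_indic/measurable_xsection.
  rewrite integral_indic ?setIT //; last exact: measurable_xsection.
  rewrite [in RHS]mulrAC [in RHS]EFinM /sectionr fineK //.
  exact/fin_num_measure/measurable_xsection.
(* The point integrated out leaves a factor that depends on the last [n] points only; it is absorbed
   into the weight [h], which is arbitrary for this purpose. *)
rewrite (IH (fun x => h x * sectionr A x)).
- by apply: eq_integral => x _; rewrite exprS mulrA.
- by apply: measurable_funM => //; apply: measurable_sectionr.
- by move=> x; rewrite mulr_ge0 ?sectionr_ge0.
Qed.
End Exchange.

Section ExchangeBound.
Context d (T : measurableType d) (R : realType).
Variable mu : probability T R.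

Lemma iid_law_pair n (i i' : 'I_n) (B : set (T * T)) : i != i' -> measurable B ->
  iid_law mu n [set y | B (tnth y i, tnth y i')] = (mu \x mu)%E B.
Proof.
move=> ii' mB.
pose f (y : n.-tuple T) := (tnth y i, tnth y i').
have mf : measurable_fun setT f.
  by apply: measurable_fun_pair; exact: measurable_tnth.
pose mfun := isMeasurableFun.Build _ _ _ _ f mf.
pose F : {mfun _ >-> _} := HB.pack f mfun.
rewrite -[LHS]/(distribution (iid_law mu n) F B); apply/esym.
apply: product_measure_unique => // C D mC mD.
rewrite -[LHS]/(iid_law mu n (f @^-1` (C `*` D))).
rewrite (_ : _ @^-1` _ = rect (fun m => if m == i then C else if m == i' then D else setT)).
  rewrite iid_law_rect; last by move=> m; case: ifP => // _; case: ifP.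
  rewrite (bigD1 i) //= eqxx (bigD1 i') /= 1?eq_sym // (negPf ii') eqxx.
  rewrite big1 ?mule1 // => m /andP[/negPf -> /negPf ->].
  exact: probability_setT.
apply/seteqP; split => x /=.
  by move=> [Cx Dx] m; case: eqP => [->//|_]; case: eqP => [->|].
move=> h; split; first by have := h i; rewrite eqxx.
by have := h i'; rewrite eq_sym (negPf ii') eqxx.
Qed.

Lemma ties_negligible n (phi : T -> R) (i i' : 'I_n) : i != i' ->
  measurable_fun [set: T] phi -> (forall t, mu [set x | phi x = t] = 0) ->
  (iid_law mu n).-negligible [set y | phi (tnth y i) = phi (tnth y i')].
Proof.
move=> ii' mphi phi0.
pose B := [set z : T * T | phi z.1 = phi z.2].
have mB : measurable B.
  have -> : B = (fun z => phi z.1 - phi z.2) @^-1` [set 0].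
    by apply/seteqP; split => z /=; move=> /eqP; rewrite ?subr_eq0 => /eqP;
       rewrite /B /= => ->; rewrite ?subrr.
  rewrite -[X in measurable X]setTI; apply: measurable_funB => //;
    by [apply: (measurableT_comp mphi)|apply: measurable_set1].
exists [set y | B (tnth y i, tnth y i')]; split => //.
  rewrite -[X in measurable X]setTI; apply: measurable_fun_pair => //; exact: measurable_tnth.
rewrite iid_law_pair // /product_measure1 integral0_eq // => x _ /=.
rewrite -[RHS](phi0 (phi x)); congr (mu _); rewrite xsectionE.
by apply/seteqP; split => y /=; rewrite /B /= => ->.
Qed.

(** By exchangeability the integral is the same for each of the [(a + n) ^_ a] injective choices
    [f], when [s f] rearranges the points. The sum over all choices is bounded by [K] almost
    everywhere, so one term has mean at most [K / (a + n) ^_ a]. *)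
Lemma exchange_le n a (J : Type) (js : seq J) (A : J -> set (n.-tuple T * T))
    (w : J -> R) (K : R) (s : {ffun 'I_a -> 'I_(a + n)} -> 'S_(a + n)) :
  (forall j, measurable (A j)) -> (forall j, 0 <= w j) -> 0 <= K ->
  {ae iid_law mu (a + n), forall y,
    \sum_(f : {ffun 'I_a -> 'I_(a + n)} | injectiveb f)
      \sum_(j <- js) w j * front_in R (A j) (tuple_perm (s f) y) <= K} ->
  (\sum_(j <- js) \int[iid_law mu n]_x (w j * sectionr mu (A j) x ^+ a)%:E
     <= (K / ((a + n) ^_ a)%:R)%:E)%E.
Proof.
move=> mA w0 K0 aeK.
pose g (y : (a + n).-tuple T) : R := \sum_(j <- js) w j * front_in R (A j) y.
have mg : measurable_fun setT (EFin \o g).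
  apply/measurable_EFinP/measurable_sum => j.
  by apply: measurable_funM => //; apply: measurable_front_in.
have g0 y : 0 <= g y.
  by apply: sumr_ge0 => j _; rewrite mulr_ge0 ?front_in_ge0.
have -> : (\sum_(j <- js) \int[iid_law mu n]_x (w j * sectionr mu (A j) x ^+ a)%:E =
    \int[iid_law mu (a + n)]_y (g y)%:E)%E.
  under eq_bigr => j _ do rewrite -(@integral_front_in _ _ _ _ a n (A j) (fun=> w j)) //.
  rewrite -ge0_integral_sum //.
  - by apply: eq_integral => y _; rewrite sumEFin.
  - move=> j; apply/measurable_EFinP/measurable_funM => //; exact: measurable_front_in.
  - by move=> j y _; rewrite lee_fin mulr_ge0 ?front_in_ge0.
have mgs f : measurable_fun setT (fun y => (g (tuple_perm (s f) y))%:E).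
  by apply: (measurableT_comp mg); apply: measurable_tuple_perm.
have : (\sum_(f : {ffun 'I_a -> 'I_(a + n)} | injectiveb f)
    \int[iid_law mu (a + n)]_y (g (tuple_perm (s f) y))%:E <= K%:E)%E.
  rewrite -big_filter -ge0_integral_sum //; last first.
    by move=> f y _; rewrite lee_fin.
  apply: (@le_trans _ _ (\int[iid_law mu (a + n)]_y (cst K%:E y))%E); last first.
    by rewrite integral_cst // [X in (_ * X)%E]probability_setT mule1.
  apply: ae_ge0_le_integral => //.
  - by move=> y _; apply: sume_ge0 => f _; rewrite lee_fin.
  - exact: emeasurable_sum.
  - case: aeK => N [mN N0 hN]; exists N; split => // y hy; apply: hN => /= h.
    by apply: hy => _; rewrite sumEFin lee_fin big_filter.
under eq_bigr => f _ do rewrite (iid_law_perm _ _ mg) ?lee_fin //.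
rewrite sumr_const.
set G := integral _ _ _; move=> h.
have N0 : 0 < ((a + n) ^_ a)%:R :> R by rewrite ltr0n ffact_gt0 leq_addr.
rewrite EFinM lee_pdivlMr // muleC mule_natl.
have := card_inj_ffuns 'I_a 'I_(a + n); rewrite !card_ord cardsE => <-.
exact: h.
Qed.

End ExchangeBound.

(** * Measurability and total mass of the regions *)

Lemma measurable_forall_fin d (T : measurableType d) (I : finType) (P : I -> set T) :
  (forall i, measurable (P i)) -> measurable [set x | forall i, P i x].
Proof.
move=> mP; rewrite (_ : [set x | _] = \big[setI/setT]_i P i).
  exact: bigsetI_measurable.
rewrite -bigcap_seq; apply/seteqP; split => x /= h i; first by move=> _; apply: h.
by apply: h; rewrite /= mem_index_enum.
Qed.

Lemma measurable_fun_cases d d' (T : measurableType d) (T' : measurableType d')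
    (V : finType) (pt : T -> V) (G : V -> T -> T') :
  (forall v, measurable [set x | pt x = v]) -> (forall v, measurable_fun setT (G v)) ->
  measurable_fun setT (fun x => G (pt x) x).
Proof.
move=> mpt mG _ B mB; rewrite setTI.
rewrite (_ : _ @^-1` _ = \big[setU/set0]_v ([set x | pt x = v] `&` G v @^-1` B)).
  apply: bigsetU_measurable => v _; apply: measurableI => //.
  by rewrite -[X in measurable X]setTI; apply: mG.
rewrite -bigcup_seq; apply/seteqP; split => x /=.
  by move=> h; exists (pt x) => //=; rewrite mem_index_enum.
by case=> v _ [/= -> ].
Qed.

Section RegionMeasurable.
Variables (R : realType) (k : nat) (a b : k.-tuple (\bar R)) (p : seq nat -> nat).

Lemma measurable_coord i : measurable_fun [set: k.-tuple R] (@coord R k i).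
Proof.
case: (ltnP i k) => ik.
  rewrite (_ : coord i = (@tnth _ R)^~ (Ordinal ik)); first exact: measurable_tnth.
  by apply/funext => x; rewrite /coord (tnth_nth 0).
rewrite (_ : coord i = cst 0); first exact: measurable_cst.
by apply/funext => x; rewrite /coord nth_default // size_tuple.
Qed.

Variables (n l : nat).
Local Notation X := (k.-tuple R).
Implicit Types (xs : n.-tuple X) (v : {ffun 'I_l * 'I_n * 'I_n -> bool}).

(** Sorting, and with it the positions of the assigned points, depends on the sample only through
    this finite table of comparisons. Measurability can then be checked on each of finitely many
    events. *)
Definition pattern xs : {ffun 'I_l * 'I_n * 'I_n -> bool} :=
  [ffun c : 'I_l * 'I_n * 'I_n => coord c.1.1 (tnth xs c.1.2) <= coord c.1.1 (tnth xs c.2)].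

Definition pattern_rel v i : rel 'I_n :=
  fun u w => [exists c : 'I_l, (c == i :> nat) && v (c, u, w)].

Fixpoint assigned_index v (j : seq nat) i : seq 'I_n :=
  if i is i'.+1 then
    let s := nth 0%N j i' in
    let ys := assigned_index v j i' in
    let rk := cut_rank (p (take i' j)) (size ys) in
    drop (rk s) (take (rk s.+1) (sort (pattern_rel v i') ys))
  else enum 'I_n.

Lemma pattern_relE xs i : (i < l)%N ->
  pattern_rel (pattern xs) i = relpre (tnth xs) (fun x y : X => x`_i <= y`_i).
Proof.
move=> il; apply/funext => u; apply/funext => w; apply/existsP/idP => /=.
  by move=> [c /andP[/eqP <-]]; rewrite ffunE.
by move=> h; exists (Ordinal il); rewrite ffunE eqxx.
Qed.

Lemma assigned_indexE xs j i : (i <= l)%N ->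
  assigned p xs j i = map (tnth xs) (assigned_index (pattern xs) j i).
Proof.
elim: i => [_|i IH il]; first by rewrite /= map_tnth_enum.
by rewrite /= IH ?(ltnW il) // size_map sort_map pattern_relE // map_drop map_take.
Qed.

Lemma measurable_pattern v : measurable [set xs | pattern xs = v].
Proof.
rewrite (_ : [set xs | _] = [set xs | forall c : 'I_l * 'I_n * 'I_n, (fun xs => coord c.1.1 (tnth xs c.1.2)
    <= coord c.1.1 (tnth xs c.2)) xs = v c]).
  apply: (measurable_forall_fin (P := fun c : 'I_l * 'I_n * 'I_n => [set xs | (coord c.1.1 (tnth xs c.1.2)
    <= coord c.1.1 (tnth xs c.2)) = v c])) => c.
  have h : measurable_fun [set: n.-tuple X]
      (fun xs => coord c.1.1 (tnth xs c.1.2) <= coord c.1.1 (tnth xs c.2)).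
    by apply: measurable_fun_ler; apply: (measurableT_comp (@measurable_coord _));
      apply: measurable_tnth.
  by rewrite -[X in measurable X]setTI; exact: (h measurableT [set v c]).
apply/seteqP; split => xs /=; first by move=> <- c; rewrite ffunE.
by move=> h; apply/ffunP => c; rewrite ffunE h.
Qed.

(** On the event of a given pattern, a cut is either a constant or a fixed coordinate of a sample
    point at a fixed position. *)
Lemma measurable_cutpoint j i s : (i < l)%N ->
  measurable_fun [set: n.-tuple X] (fun xs => cutpoint a b p xs j i s).
Proof.
move=> il.
pose G v xs : \bar R := let q := p (take i j) in
  if s == 0%N then nth -oo%E a i
  else if s == q.+1 then nth +oo%E b i
  else ([seq coord i (tnth xs u) | u <- sort (pattern_rel v i) (assigned_index v j i)]`_
          (cut_rank q (size (assigned_index v j i)) s).-1)%:E.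
rewrite (_ : (fun xs => _) = (fun xs => G (pattern xs) xs)); last first.
  apply/funext => xs; rewrite /cutpoint /G; case: eqP => // _; case: eqP => // _.
  rewrite assigned_indexE ?(ltnW il) // -map_comp size_map sort_map.
  by rewrite pattern_relE.
apply: measurable_fun_cases; first exact: measurable_pattern.
move=> v; rewrite /G; case: eqP => // _; case: eqP => // _.
apply/measurable_EFinP; set ys := sort _ _; set m := _.-1.
case: (ltnP m (size ys)) => mys; last first.
  rewrite (_ : (fun xs => _) = cst 0); first exact: measurable_cst.
  by apply/funext => xs; rewrite nth_default // size_map.
have u0 : 'I_n by case: ys mys => // u.
rewrite (_ : (fun xs => _) = (fun xs => coord i (tnth xs (nth u0 ys m)))).
  by apply: (measurableT_comp (@measurable_coord _)); apply: measurable_tnth.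
by apply/funext => xs; rewrite (nth_map u0).
Qed.

Lemma measurable_box : measurable (box a b).
Proof.
apply: (measurable_forall_fin (P := fun i => [set x : X |
  (tnth a i <= (tnth x i)%:E <= tnth b i)%E])) => i.
have mi : measurable_fun [set: X] (fun x => (tnth x i)%:E).
  by apply/measurable_EFinP; apply: measurable_tnth.
rewrite (_ : [set x | _] = [set x | (tnth a i <= (tnth x i)%:E)%E] `&`
    [set x | ((tnth x i)%:E <= tnth b i)%E]).
  by apply: measurableI; rewrite -[X in measurable X]setTI; apply: measurable_lee.
by apply/seteqP; split => x /=; move=> /andP.
Qed.

Definition region_graph j : set (n.-tuple X * X) :=
  [set z : n.-tuple X * X | region a b p z.1 j z.2].

Lemma measurable_region_graph j : (size j <= l)%N -> measurable (region_graph j).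
Proof.
move=> jl; pose P (c : 'I_(size j)) := [set z : n.-tuple X * X |
   (cutpoint a b p z.1 j c (nth 0%N j c) < (coord c z.2)%:E)%E] `&` [set z : n.-tuple X * X |
   ((coord c z.2)%:E <= cutpoint a b p z.1 j c (nth 0%N j c).+1)%E].
rewrite (_ : region_graph j = snd @^-1` box a b `&` [set z | forall c, P c z]).
  apply: measurableI.
    by rewrite -[X in measurable X]setTI; apply: measurable_snd => //; exact: measurable_box.
  apply: measurable_forall_fin => c.
  have cl : (c < l)%N by apply: leq_trans jl.
  have mc : measurable_fun [set: n.-tuple X * X] (fun z => (coord c z.2)%:E).
    apply/measurable_EFinP; apply: (measurableT_comp (@measurable_coord _)).
    exact: measurable_snd.
  have mq s : measurable_fun [set: n.-tuple X * X] (fun z => cutpoint a b p z.1 j c s).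
    by apply: (measurableT_comp (measurable_cutpoint _ _ cl)); exact: measurable_fst.
  by apply: measurableI; rewrite -[X in measurable X]setTI;
    [apply: measurable_lte|apply: measurable_lee].
apply/seteqP; split => z /= [bz h]; split => //.
  by move=> c; apply/andP; apply: h.
by move=> i ij; apply/andP; apply: (h (Ordinal ij)).
Qed.

End RegionMeasurable.

Section Atomless.
Variables (R : realType) (k : nat) (mu : probability (k.-tuple R) R).

Lemma measurable_coord_eq c t : measurable [set x : k.-tuple R | coord c x = t].
Proof.
rewrite -[X in measurable X]setTI.
exact: (@measurable_coord R k c measurableT _ (measurable_set1 t)).
Qed.

Lemma measurable_coord_le (f : 'I_k -> R) :
  measurable [set y : k.-tuple R | forall i, tnth y i <= f i].
Proof.
apply: (measurable_forall_fin (P := fun i => [set y : k.-tuple R | tnth y i <= f i])) => i.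
rewrite -[X in measurable X]setTI.
have h : measurable_fun [set: k.-tuple R] (fun y => tnth y i <= f i).
  by apply: measurable_fun_ler; [exact: measurable_tnth|exact: measurable_cst].
exact: (h measurableT [set true]).
Qed.

(* A jump of the joint cdf along coordinate [c] bounds the mass that the
   hyperplane [x_c = t] puts on the points whose coordinates are at most [M]. *)
Lemma continuous_distribution_atomless : continuous_distribution mu ->
  forall c t, (c < k)%N -> mu [set x | coord c x = t] = 0%E.
Proof.
move=> cont c t ck; pose i0 := Ordinal ck.
pose v M s : 'rV[R]_k := \row_i (if i == i0 then s else M).
pose N M := [set x : k.-tuple R | coord c x = t] `&`
            [set y : k.-tuple R | forall i, tnth y i <= v M t ord0 i].
have mN M : measurable (N M).
  by apply: measurableI; [exact: measurable_coord_eq|exact: measurable_coord_le].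
have coordE (x : k.-tuple R) : coord c x = tnth x i0 by rewrite (tnth_nth 0).
have N0 M : mu (N M) = 0%E.
  apply/eqP; rewrite -measure_le0; apply/lee_addgt0Pr => e e0; rewrite add0e.
  have := cont (v M t) => /cvgr_dist_lt /(_ _ e0) /nbhs_ballP [d /= d0 hd].
  have /hd : ball (v M t) d (v M (t - d / 2)).
    split=> // i j; rewrite !mxE; case: ifP => _; last exact: ballxx.
    by rewrite /ball /= opprB addrC subrK gtr0_norm ?divr_gt0 // ltr_pdivrMr // ltr_pMr // ltr1n.
  rewrite /joint_cdf; set A := [set y | _]; set B := [set y | _] => AB.
  have mA : measurable A by exact: measurable_coord_le.
  have mB : measurable B by exact: measurable_coord_le.
  have NAB : mu (N M) = (mu (N M `|` B) - mu B)%E.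
    rewrite measureU //; last first.
      apply/seteqP; split => // x [[/= xt _] /(_ i0)].
      by rewrite mxE eqxx -coordE xt => h; exfalso; move: h d0; lra.
    by rewrite addeK // fin_num_measure.
  rewrite NAB leeBlDr ?fin_num_measure //.
  apply: (@le_trans _ _ (mu A)).
    apply: le_measure; rewrite ?inE //; first exact: measurableU.
    move=> y [[_ h] //|h i]; apply: le_trans (h i) _; rewrite !mxE.
    by case: ifP => // _; move: d0; lra.
  rewrite -(@fineK _ (mu A)) ?fin_num_measure // -(@fineK _ (mu B)) ?fin_num_measure //.
  by rewrite -EFinD lee_fin -lerBlDr; apply: ltW; apply: le_lt_trans AB; exact: ler_norm.
apply/(negligibleP _ (measurable_coord_eq _ _)).
apply: (@negligibleS _ _ _ _ (\bigcup_m N m%:R)); last first.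
  by apply: negligible_bigcup => m; apply/(negligibleP _ (mN m%:R)); apply: N0.
move=> x /= xt.
(* Every point of the hyperplane lies in [N M] once [M] exceeds the sum of its absolute coordinates,
   so countably many null sets cover it. *)
pose S : R := \sum_(i < k) `|tnth x i|.
have S0 : 0 <= S by apply: sumr_ge0.
exists (Num.trunc S).+1 => //; split => //= i; rewrite mxE.
case: eqP => [->|_]; first by rewrite -coordE xt.
apply: le_trans (ltW (truncnS_gt S)); apply: le_trans (ler_norm _) _.
by rewrite /S (bigD1 i) //= lerDl; apply: sumr_ge0.
Qed.

End Atomless.

(** * The regions partition the box up to a null set *)

Section Partition.
Variables (R : realType) (k l : nat) (a b : k.-tuple (\bar R)) (p : seq nat -> nat).
Hypothesis lk : (l <= k)%N.
Variable xs : seq (k.-tuple R).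
Local Notation X := (k.-tuple R).

Definition in_slice j (x : X) i s : bool :=
  (cutpoint a b p xs j i s < (x`_i)%:E <= cutpoint a b p xs j i s.+1)%E.

Definition in_slices j x i : bool := [forall m : 'I_i, in_slice j x m (nth 0%N j m)].

(** Only the inner cuts are compared: [xs] is an arbitrary sequence, whose points may lie outside
    the box, so the end cuts need not be in order with the others. *)
Lemma cutpoint_le j i s t : (0 < s <= t)%N -> (t <= p (take i j))%N ->
  (cutpoint a b p xs j i s <= cutpoint a b p xs j i t)%E.
Proof.
move=> /andP[s0 st] tp; rewrite /cutpoint gtn_eqF // ltn_eqF ?ltnS ?(leq_trans st) //.
rewrite gtn_eqF ?(leq_trans s0) // ltn_eqF ?ltnS // lee_fin.
set ys := assigned _ _ _ _; set vs := sort _ _; set q := p _.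
have [ys0|ys0] := posnP (size ys).
  by move: ys0 => /size0nil ys0; rewrite /vs ys0.
have svs : sorted <=%R vs by apply: sort_sorted; exact: le_total.
have szvs : size vs = size ys by rewrite size_sort size_map.
have rks : (cut_rank q (size ys) s <= cut_rank q (size ys) t)%N.
  by apply: leq_div2r; rewrite leq_mul2l st orbT.
have rkt : ((cut_rank q (size ys) t).-1 < size ys)%N.
  have : (cut_rank q (size ys) t <= size ys)%N.
    rewrite -[leqRHS](mulnK _ (ltn0Sn q)); apply: leq_div2r.
    by rewrite leq_mul2l leqW ?orbT.
  by case: (cut_rank _ _ t) => //=; rewrite ys0.
rewrite le_sorted_leq_nth // ?inE ?szvs // -?subn1 ?leq_sub2r //.
by rewrite (leq_ltn_trans _ rkt) // -!subn1 leq_sub2r.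
Qed.

(** Let [e s] say that the coordinate is at most cut [s]. It switches once from false to true, even
    if inner cuts coincide, and membership in slice [s] is [e s.+1 - e s], so the sum telescopes. A
    point on the lower face is in no slice, as the intervals are open below. *)
Lemma sum_in_slice j (x : X) i : (i < l)%N -> box a b x ->
  nth -oo%E a i != (x`_i)%:E ->
  (\sum_(s <- iota 0 (p (take i j)).+1) in_slice j x i s)%N = 1%N.
Proof.
move=> il bx xa; set q := p _.
pose e s := ((x`_i)%:E <= cutpoint a b p xs j i s)%E.
have ik : (i < k)%N by exact: leq_trans lk.
have /andP[ax xb] := bx (Ordinal ik).
have e0 : e 0%N = false.
  apply/negbTE; rewrite -ltNge /cutpoint eqxx lt_neqAle xa /=.
  by move: ax; rewrite !(tnth_nth -oo%E) (tnth_nth 0).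
have eq1 : e q.+1 = true.
  rewrite /e /cutpoint /= eqxx.
  by move: xb; rewrite (tnth_nth +oo%E) (tnth_nth 0).
have eS s : (s <= q)%N -> (e s <= e s.+1)%N.
  move=> sq; case: (boolP (e s)) => // es; rewrite lt0b.
  have [s0|s0] := posnP s; first by move: es; rewrite s0 e0.
  move: sq; rewrite leq_eqVlt => /orP[/eqP ->|sq]; first by rewrite eq1.
  by apply: le_trans es _; apply: cutpoint_le => //; rewrite s0 leqnSn.
have -> : (\sum_(s <- iota 0 q.+1) in_slice j x i s =
    \sum_(0 <= s < q.+1) (e s.+1 - e s))%N.
  rewrite /index_iota subn0 big_seq [RHS]big_seq; apply: eq_bigr => s.
  rewrite mem_iota add0n ltnS /= => /eS; rewrite /in_slice ltNge -/(e s) -/(e s.+1).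
  by case: (e s); case: (e s.+1).
rewrite telescope_sumn_in ?eq1 ?e0 // => s /=; exact: eS.
Qed.
Lemma assigned_prefix j j' i : (i <= size j)%N ->
  assigned p xs (j ++ j') i = assigned p xs j i.
Proof.
elim: i => //= i IH ij; rewrite IH ?(ltnW ij) // takel_cat ?(ltnW ij) //.
by rewrite nth_cat ij.
Qed.

Lemma cutpoint_prefix j j' i s : (i <= size j)%N ->
  cutpoint a b p xs (j ++ j') i s = cutpoint a b p xs j i s.
Proof. by move=> ij; rewrite /cutpoint assigned_prefix // takel_cat. Qed.

Lemma in_slices_rcons j s x i : size j = i ->
  in_slices (rcons j s) x i.+1 = in_slices j x i && in_slice j x i s.
Proof.
move=> sj; rewrite -cats1 /in_slices; apply/forallP/andP => [h|[/forallP h1 h2] m].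
  split; last by have := h ord_max; rewrite /in_slice /= nth_cat sj ltnn subnn
                    !cutpoint_prefix ?sj.
  apply/forallP => m; have mi : (m < size j)%N by rewrite sj.
  by have := h (widen_ord (leqnSn i) m); rewrite /in_slice /= nth_cat mi
     !cutpoint_prefix // ltnW.
rewrite /in_slice nth_cat; have mi : (m <= size j)%N by rewrite sj -ltnS.
rewrite !cutpoint_prefix //; case: (ltnP m (size j)) => [ms|sm].
  by rewrite sj in ms; exact: (h1 (Ordinal ms)).
have mE : nat_of_ord m = i.
  by apply/eqP; rewrite eqn_leq -ltnS ltn_ord /=; rewrite sj in sm.
by rewrite mE sj subnn.
Qed.

Lemma sum_in_slices (x : X) i : (i <= l)%N -> box a b x ->
  (forall m, (m < l)%N -> nth -oo%E a m != (x`_m)%:E) ->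
  (\sum_(j <- indices p i) in_slices j x i)%N = 1%N.
Proof.
move=> il bx xa; elim: i il => [_|i IH il].
  by rewrite big_seq1; apply/eqP; rewrite eqb1; apply/forallP => -[].
rewrite (_ : indices p i.+1 =
  [seq rcons j s | j <- indices p i, s <- iota 0 (p j).+1]) // big_allpairs_dep /=.
rewrite -[RHS](IH (ltnW il)) big_seq [RHS]big_seq; apply: eq_bigr => j ji.
have sj := indices_size ji.
under eq_bigr => s _ do rewrite in_slices_rcons // -mulnb.
rewrite -big_distrr /= -{2}[j]take_size sj sum_in_slice ?muln1 //.
exact: xa.
Qed.

Lemma regionE j x : size j = l ->
  region a b p xs j x <-> box a b x /\ in_slices j x l.
Proof.
move=> sj; rewrite /region sj; split=> -[bx h]; split=> //.
  by apply/forallP => m; apply: h.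
by move=> i il; have /forallP /(_ (Ordinal il)) := h.
Qed.

End Partition.

Section RegionProbability.
Variables (R : realType) (k l : nat) (a b : k.-tuple (\bar R)) (p : seq nat -> nat).
Hypothesis lk : (l <= k)%N.
Variable mu : probability (k.-tuple R) R.
Hypothesis mu_box : mu (box a b) = 1%E.
Hypothesis mu_cont : continuous_distribution mu.
Variables (n : nat) (xs : n.-tuple (k.-tuple R)).

Lemma xsection_region_graph j :
  xsection (@region_graph R k a b p n j) xs = region a b p xs j.
Proof.
by rewrite xsectionE; apply/seteqP; split.
Qed.

Lemma discretized_sectionr j :
  discretized mu (region a b p xs) j = sectionr mu (@region_graph R k a b p n j) xs.
Proof. by rewrite /discretized /sectionr xsection_region_graph. Qed.

Lemma measurable_region j : measurable (region a b p xs j).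
Proof.
rewrite -xsection_region_graph; apply: measurable_xsection.
exact: measurable_region_graph (leqnn _).
Qed.

Lemma sum_discretized :
  \sum_(j <- indices p l) discretized mu (region a b p xs) j = 1.
Proof.
apply: EFin_inj; rewrite -sumEFin.
transitivity (\sum_(j <- indices p l) \int[mu]_x (\1_(region a b p xs j) x)%:E)%E.
  apply: eq_bigr => j _; rewrite integral_indic ?setIT //; last exact: measurable_region.
  by rewrite /discretized fineK // fin_num_measure //; exact: measurable_region.
have mI j : measurable_fun setT (fun x => (\1_(region a b p xs j) x)%:E).
  by apply/measurable_EFinP; apply: measurable_indic; exact: measurable_region.
rewrite -ge0_integral_sum //.
transitivity (\int[mu]_x (cst 1%E x))%E; last first.
  by rewrite integral_cst // mul1e; exact: probability_setT.
apply: ae_eq_integral => //; first exact: emeasurable_sum.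
(* These are the lower faces of the box. For an infinite endpoint [fine] yields 0, and the
   hyperplane obtained is null all the same. *)
pose H (m : nat) := [set x : k.-tuple R | (m < l)%N /\ coord m x = fine (nth -oo%E a m)].
apply: (@negligibleS _ _ _ _ (~` box a b `|` \bigcup_m H m)).
  move=> x /= /not_implyP [_ hx]; apply: contrapT => /not_orP [/contrapT bx hH].
  apply: hx; rewrite sumEFin; congr _%:E.
  rewrite -[RHS](congr1 (fun m : nat => m%:R) (@sum_in_slices R k l a b p lk xs x l (leqnn l) bx _)).
    rewrite natr_sum big_seq [RHS]big_seq; apply: eq_bigr => j /indices_size sj.
    rewrite indicE; congr (nat_of_bool _)%:R; apply/idP/idP.
      by rewrite inE => /(regionE _ _ _ _ _ sj) [].
    by move=> h; rewrite inE; apply/(regionE _ _ _ _ _ sj).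
  move=> m ml; apply/eqP => am; apply: hH; exists m => //; split => //.
  by rewrite am.
apply: negligibleU.
  have mB := measurable_box a b.
  apply/(negligibleP _ (measurableC mB)).
  by apply: etrans (probability_setC mu mB) _; rewrite mu_box subee.
apply: negligible_bigcup => m; case: (ltnP m l) => ml.
  apply: (@negligibleS _ _ _ _ [set x | coord m x = fine (nth -oo%E a m)]).
    by move=> x [].
  apply/negligibleP; first exact: measurable_coord_eq.
  by apply: continuous_distribution_atomless => //; exact: leq_trans lk.
rewrite (_ : H m = set0); first exact: negligible_set0.
by apply/seteqP; split => // x []; rewrite ltnNge ml.
Qed.
End RegionProbability.

Lemma leq_ffact2 u v m : (u <= v)%N -> (u ^_ m <= v ^_ m)%N.
Proof. by move=> uv; rewrite !ffact_prod; apply: leq_prod => i _; apply: leq_sub2r. Qed.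

(** * Moments bounded by counts of eligible points *)

Section MomentBound.
Variables (R : realType) (k l : nat) (a b : k.-tuple (\bar R)) (p : seq nat -> nat).
Hypothesis lk : (0 < l <= k)%N.
Variable mu : probability (k.-tuple R) R.
Hypothesis mu_cont : continuous_distribution mu.
Local Notation X := (k.-tuple R).

Lemma no_ties_ae n :
  {ae iid_law mu n, forall y : n.-tuple X, no_ties (@coord R k) l y}.
Proof.
pose H (c : nat) := [set y : n.-tuple X | (c < l)%N /\ ~ uniq (map (coord c) y)].
apply: (@negligibleS _ _ _ _ (\bigcup_c H c)).
  move=> y /= hy; apply: contrapT => hH; apply: hy => c cl.
  by apply: contrapT => nu; apply: hH; exists c.
apply: negligible_bigcup => c.
case: (ltnP c l) => cl; last first.
  rewrite (_ : H c = set0); first exact: negligible_set0.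
  by apply/seteqP; split => // y []; rewrite ltnNge cl.
pose P (i i' : 'I_n) := [set y : n.-tuple X | coord c (tnth y i) = coord c (tnth y i')].
have NP : (iid_law mu n).-negligible
   (\big[setU/set0]_(i : 'I_n) \big[setU/set0]_(i' | i != i') P i i').
  elim/big_ind: _ => [|A B|i _]; [exact: negligible_set0|exact: negligibleU|].
  elim/big_ind: _ => [|A B|i' ii']; [exact: negligible_set0|exact: negligibleU|].
  apply: ties_negligible => //; first exact: measurable_coord.
  move=> t; apply: continuous_distribution_atomless => //.
  by case/andP: lk => _ /(leq_trans cl).
apply: negligibleS NP => y [_ /= /negP nu]; apply: contrapT => hP; move/negP: nu; apply.
rewrite -(map_tnth_enum y) -map_comp map_inj_uniq ?enum_uniq // => i i' /= e.
apply/eqP/negPn/negP => ii'; apply: hP; rewrite -bigcup_seq; exists i.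
  exact: mem_index_enum.
by rewrite -bigcup_seq_cond; exists i' => //=; rewrite mem_index_enum.
Qed.

Lemma backE m n (y : (m + n).-tuple X) : back y = drop m y :> seq X.
Proof.
have [x0] : inhabited X by constructor; exact: [tuple of nseq k 0].
apply: (@eq_from_nth _ x0).
  by rewrite size_drop !size_tuple addKn.
move=> i; rewrite size_tuple => i_n; rewrite nth_drop.
rewrite -[i]/(nat_of_ord (Ordinal i_n)) -tnth_nth tnth_mktuple.
by rewrite (tnth_nth x0).
Qed.

Lemma no_ties_subseq (ys zs : seq X) : subseq ys zs ->
  no_ties (@coord R k) l zs -> no_ties (@coord R k) l ys.
Proof. by move=> s nt c cl; apply: subseq_uniq (nt c cl); exact: map_subseq. Qed.

Lemma no_ties_perm (ys zs : seq X) : perm_eq ys zs ->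
  no_ties (@coord R k) l zs -> no_ties (@coord R k) l ys.
Proof. by move=> s nt c cl; rewrite (perm_uniq (perm_map _ s)) nt. Qed.

(** Since [cell_insert] takes the configuration up to a permutation, the eligible set can be formed
    from [y] itself. It is thus the same for all choices of the front points, which makes the
    counting possible. *)
Lemma front_in_elig m n j (y : (m + n).-tuple X) (s : 'S_(m + n)) :
  j \in indices p l -> no_ties (@coord R k) l y ->
  (forall i, (i < l)%N -> (p (take i j) < npts p n j i)%N) ->
  front_in R (@region_graph R k a b p n j) (tuple_perm s y) <=
  [forall i : 'I_m, tnth y (s (lshift n i)) \in elig (@coord R k) p n m j y l]%:R.
Proof.
move=> jl nt pn; set y' := tuple_perm s y.
have yy' : perm_eq y' y by apply/tuple_permP; exists s.
case: (pselect (forall i : 'I_m, region a b p (back y') j (tnth y' (lshift n i)))); last first.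
  move=> /existsNP [i ni]; rewrite /front_in (bigD1 i) //= indicE memNset ?mul0r //.
move=> hr; have -> : [forall i : 'I_m, tnth y (s (lshift n i)) \in elig (@coord R k) p n m j y l].
  have vj := indices_valid jl; have sj := indices_size jl.
  have perm_y : perm_eq y (take m y' ++ back y').
    by rewrite backE cat_take_drop perm_sym.
  have sW : size (take m y') = m by rewrite size_takel // size_tuple leq_addr.
  have ntD : no_ties (@coord R k) l (back y').
    by rewrite backE; apply: no_ties_subseq (drop_subseq _ _) _; apply: no_ties_perm yy' nt.
  have [] := @cell_insert _ _ (@coord R k) p l n m j y (take m y') (back y') nt vj perm_y
    sW (size_tuple _) _ l (leqnn l).
    move=> w i /(nthP w) [r]; rewrite sW => rm <- il; rewrite nth_take //.
    have := hr (Ordinal rm); rewrite (tnth_nth w) /= => rw.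
    exact: (region_rank ntD vj sj (size_tuple _) pn rw il).
  move=> _ hW; apply/forallP => i; apply: hW.
  rewrite -[y in tnth y _]/y (_ : tnth y _ = tnth y' (lshift n i)); last by rewrite tnth_mktuple.
  rewrite (tnth_nth (tnth y' (lshift n i))) /= -(@nth_take m) //.
  by apply: mem_nth; rewrite sW.
by apply: prodr_ile1 => i _; rewrite indicE; case: (_ \in _); rewrite ?ler01 ?lexx.
Qed.

(** A choice contributes at most one, and only if it is an injection into the eligible positions;
    the falling factorial counts these injections. *)
Lemma sum_front_in_le m n j (y : (m + n).-tuple X) (s : {ffun 'I_m -> 'I_(m + n)} -> 'S_(m + n)) :
  (forall f : {ffun 'I_m -> 'I_(m + n)}, injectiveb f -> forall i, s f (lshift n i) = f i) ->
  j \in indices p l -> no_ties (@coord R k) l y ->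
  (forall i, (i < l)%N -> (p (take i j) < npts p n j i)%N) ->
  \sum_(f : {ffun 'I_m -> 'I_(m + n)} | injectiveb f)
    front_in R (@region_graph R k a b p n j) (tuple_perm (s f) y) <=
  (size (elig (@coord R k) p n m j y l) ^_ m)%:R.
Proof.
move=> hs jl nt pn; set E := elig _ _ _ _ _ _ _.
pose U := [pred i : 'I_(m + n) | tnth y i \in E].
have uy : uniq y by have := nt 0%N; case/andP: lk => l0 _ /(_ l0) /map_uniq.
have UE : (#|U| <= size E)%N.
  rewrite cardE -(size_map (tnth y) (enum U)); apply: uniq_leq_size.
    by rewrite map_inj_uniq ?enum_uniq //; apply/tuple_uniqP.
  by move=> x /mapP [i]; rewrite mem_enum => + ->.
apply: (@le_trans _ _ (#|U| ^_ m)%:R); last by rewrite ler_nat leq_ffact2.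
have := @card_inj_ffuns_on 'I_m _ U; rewrite card_ord => <-.
apply: (@le_trans _ _ (\sum_(f : {ffun 'I_m -> 'I_(m + n)} | injectiveb f)
   (f \in ffun_on U)%:R)).
  apply: ler_sum => f injf; apply: le_trans (front_in_elig _ jl nt pn) _.
  rewrite ler_nat; case: (boolP [forall i, _]) => //= /forallP h.
  rewrite lt0b; apply/ffun_onP => i; rewrite inE -(hs f injf).
  exact: h.
by rewrite -natr_sum ler_nat -big_mkcondr sum1dep_card eq_leq //;
  apply: eq_card => f; rewrite !inE andbC.
Qed.

(** The bound is asked for the weighted sum over all regions, because the total of the eligible
    counts is known more precisely than each of them. *)
Lemma moment_le m n (w : seq nat -> R) (K : R) :
  (forall j, 0 <= w j) ->
  (forall j i, j \in indices p l -> (i < l)%N -> (p (take i j) < npts p n j i)%N) ->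
  (forall y : (m + n).-tuple X, no_ties (@coord R k) l y ->
    \sum_(j <- indices p l) w j * (size (elig (@coord R k) p n m j y l) ^_ m)%:R <= K) ->
  0 <= K ->
  (\sum_(j <- indices p l) \int[iid_law mu n]_x
      (w j * sectionr mu (@region_graph R k a b p n j) x ^+ m)%:E
     <= (K / ((m + n) ^_ m)%:R)%:E)%E.
Proof.
move=> w0 pn hK K0.
have /choice [s hs] : forall f : {ffun 'I_m -> 'I_(m + n)}, exists s : 'S_(m + n),
    injectiveb f -> forall i, s (lshift n i) = f i.
  move=> f; case: (boolP (injectiveb f)) => [/injectiveP injf|]; last by exists 1%g.
  by have [s hs] := perm_extends injf (@lshift_inj m n); exists s.
apply: (@exchange_le _ _ _ mu n m _ _ _ w K s) => //.
  by move=> j; exact: measurable_region_graph (leqnn _).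
apply: filterS (no_ties_ae (m + n)) => y nt; apply: le_trans (hK y nt).
rewrite exchange_big /= big_seq [leRHS]big_seq; apply: ler_sum => j jl.
rewrite -mulr_sumr ler_wpM2l //; apply: sum_front_in_le => // i il.
exact: pn.
Qed.

End MomentBound.

(** * Moments of the region probabilities *)

Section HellingerBound.
Variable R : realType.

Lemma sqr_sqrtB_le (m r : R) : 0 <= m -> 0 < r -> r / 2 <= m ->
  (Num.sqrt m - Num.sqrt r) ^+ 2 <= (m - r) ^+ 2 / (2 * r).
Proof.
move=> m0 r0 rm; set x := Num.sqrt m; set y := Num.sqrt r.
have xm : x ^+ 2 = m by rewrite sqr_sqrtr.
have yr : y ^+ 2 = r by rewrite sqr_sqrtr // ltW.
have x0 : 0 <= x by exact: sqrtr_ge0.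
have y0 : 0 < y by rewrite sqrtr_gt0.
(* A quarter is enough: [(x + y) ^ 2 = m + r + 2 x y] is then at least [r / 2 + r + r / 2 = 2 r]. *)
have h : y / 4 <= x.
  rewrite -(@ler_pXn2r _ 2) ?nnegrE ?divr_ge0 ?(ltW y0) // expr_div_n xm yr.
  by move: rm r0; lra.
rewrite ler_pdivlMr ?mulr_gt0 //.
have -> : m - r = (x - y) * (x + y) by rewrite -subr_sqr xm yr.
rewrite exprMn ler_wpM2l ?sqr_ge0 // sqrrD xm yr.
have : y / 4 * y <= x * y by rewrite ler_wpM2r // ltW.
have -> : y / 4 * y = r / 4 by rewrite mulrAC -expr2 yr.
by rewrite -[x * y *+ 2]mulr_natl; move: rm r0; lra.
Qed.

(* Half the chi-square distance bounds the squared Hellinger distance as long as no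
   [m j] is below [r j / 2]; as both vectors sum to 1, the opposite forces some
   [m i] above [(1 + rmin / 2) * r i], and the last sum is then at least 2. *)
Lemma hellinger_le (J : eqType) (js : seq J) (m r : J -> R) (rmin : R) (e : nat) :
  0 < rmin -> (forall j, j \in js -> rmin <= r j) -> (forall j, 0 <= m j) ->
  \sum_(j <- js) m j = 1 -> \sum_(j <- js) r j = 1 ->
  \sum_(j <- js) (Num.sqrt (m j) - Num.sqrt (r j)) ^+ 2 + 1 / 2 <=
  \sum_(j <- js) (2 * r j)^-1 * m j ^+ 2 +
  \sum_(j <- js) 2 * (((1 + rmin / 2) * r j) ^- e * m j ^+ e).
Proof.
move=> rmin0 rminP m0 sm sr; set c := rmin / 2.
have c0 : 0 < c by rewrite divr_gt0.
have r0 j : j \in js -> 0 < r j by move=> /rminP; apply: lt_le_trans.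
have chi : \sum_(j <- js) (2 * r j)^-1 * m j ^+ 2 =
    \sum_(j <- js) (m j - r j) ^+ 2 / (2 * r j) + 1 / 2.
  transitivity (\sum_(j <- js) ((m j - r j) ^+ 2 / (2 * r j) + (m j - r j / 2))).
    rewrite big_seq [RHS]big_seq; apply: eq_bigr => j /r0 rj; field.
    by rewrite lt0r_neq0.
  by rewrite big_split /= sumrB -mulr_suml sm sr; congr (_ + _); field.
have c1 : 0 < 1 + c by rewrite addr_gt0.
have tj j : j \in js -> 0 <= 2 * (((1 + c) * r j) ^- e * m j ^+ e).
  move=> /r0 rj; rewrite mulr_ge0 // mulr_ge0 ?invr_ge0 ?exprn_ge0 //.
  by rewrite mulr_ge0 ?ltW.
have tail0 : 0 <= \sum_(j <- js) 2 * (((1 + c) * r j) ^- e * m j ^+ e).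
  by rewrite big_seq; apply: sumr_ge0 => j /tj.
case: (boolP (all (fun j => m j <= (1 + c) * r j) js)) => [/allP hall|].
  apply: le_trans (_ : _ <= \sum_(j <- js) (2 * r j)^-1 * m j ^+ 2) _; last by rewrite lerDl.
  rewrite chi lerD2r big_seq [leRHS]big_seq; apply: ler_sum => j jjs.
  apply: sqr_sqrtB_le => //; first exact: r0.
  (* These slacks are nonnegative and add up to [c], so each is at most [c <= r j / 2]; this forces
     [m j >= r j / 2]. *)
  have sc : \sum_(i <- js) ((1 + c) * r i - m i) = c.
    by rewrite sumrB -mulr_sumr sm sr; ring.
  have : (1 + c) * r j - m j <= c.
    rewrite -[leRHS]sc (big_rem j) //= lerDl big_seq; apply: sumr_ge0 => i /mem_rem ijs.
    by rewrite subr_ge0 hall.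
  have := rminP j jjs; have : 0 < c * r j by rewrite mulr_gt0 // r0.
  have c2 : rmin = 2 * c by rewrite /c; field.
  by rewrite mulrDl mul1r c2; move: (c * r j) => cr; lra.
rewrite -has_predC => /hasP [j jjs /=]; rewrite -ltNge => mj.
(* The factor 2 in the last sum of the statement is chosen to match this trivial bound. *)
have h2 : \sum_(j <- js) (Num.sqrt (m j) - Num.sqrt (r j)) ^+ 2 <= 2.
  apply: (@le_trans _ _ (\sum_(j <- js) (m j + r j))).
    rewrite big_seq [leRHS]big_seq; apply: ler_sum => i /r0 ri.
    rewrite sqrrB !sqr_sqrtr // ?(ltW ri) //.
    have : 0 <= Num.sqrt (m i) * Num.sqrt (r i) by rewrite mulr_ge0 ?sqrtr_ge0.
    by rewrite mulr2n; move: (Num.sqrt _ * _) => t; lra.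
  by rewrite big_split /= sm sr.
have h3 : 2 <= \sum_(j <- js) 2 * (((1 + c) * r j) ^- e * m j ^+ e).
  rewrite (big_rem j) //=; apply: (@le_trans _ _ (2 * (((1 + c) * r j) ^- e * m j ^+ e))).
    rewrite ler_peMr // mulrC -expr_div_n exprn_ege1 // ler_pdivlMr ?mul1r ?ltW //.
    by rewrite mulr_gt0 ?addr_gt0 ?r0.
  by rewrite lerDl big_seq; apply: sumr_ge0 => i /mem_rem /tj.
have h4 : 0 <= \sum_(j <- js) (m j - r j) ^+ 2 / (2 * r j).
  rewrite big_seq; apply: sumr_ge0 => i /r0 ri.
  by rewrite divr_ge0 ?sqr_ge0 // mulr_ge0 ?ltW.
by rewrite chi; move: h2 h3 h4; lra.
Qed.

End HellingerBound.

Section Moments.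
Variables (R : realType) (k l : nat) (a b : k.-tuple (\bar R)) (p : seq nat -> nat).
Hypothesis lk : (0 < l <= k)%N.
Variable mu : probability (k.-tuple R) R.
Hypothesis mu_cont : continuous_distribution mu.
Local Notation X := (k.-tuple R).
Local Notation J := (indices p l).
Local Notation r := (@share R p l).

Lemma share_min : exists2 rmin : R, 0 < rmin <= 1 & forall j, j \in J -> rmin <= r j.
Proof.
elim: J => [|j js [rmin /andP[r0 r1] h]]; first by exists 1; rewrite ?ltr01 ?lexx.
exists (Num.min rmin (r j)); first by rewrite lt_min r0 share_gt0 ge_min r1.
by move=> i; rewrite inE => /orP[/eqP ->|/h]; rewrite ge_min ?lexx ?orbT // => ->.
Qed.

(** A parent cell has nominal probability at least [rmin (p + 1)], hence at least
    [(l + 1) (p + 1) - i] points, which is more than [p]. For such [n] no inner cut has rank 0. *)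
Lemma npts_large rmin n j i : j \in J -> (forall j, j \in J -> rmin <= r j) -> 0 < rmin ->
  l.+1%:R <= n%:R * rmin -> (i < l)%N -> (p (take i j) < npts p n j i)%N.
Proof.
move=> jJ rminP r0 hn il; rewrite -(@ler_nat R).
have := npts_share R p n j i; rewrite ler_norml => /andP[h _].
have h1 : n%:R * (rmin * (p (take i j)).+1%:R) <= n%:R * share R p i j.
  rewrite ler_wpM2l // -ler_pdivlMr ?ltr0n // -shareS.
  by apply: le_trans (rminP j jJ) _; apply: share_le.
have h2 : l.+1%:R * (p (take i j)).+1%:R <= n%:R * (rmin * (p (take i j)).+1%:R) :> R.
  by rewrite mulrA ler_wpM2r.
have h3 : (i + (p (take i j)).+1)%:R <= l.+1%:R * (p (take i j)).+1%:R :> R.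
  by rewrite -natrM ler_nat; nia.
by move: h h1 h2 h3; rewrite natrD; lra.
Qed.

Lemma size_elig_bounds n m j (y : (m + n).-tuple X) : j \in J ->
  no_ties (@coord R k) l y ->
  (npts p n j l + m <= size (elig (@coord R k) p n m j y l) + l)%N /\
  (size (elig (@coord R k) p n m j y l) <= npts p n j l + m)%N.
Proof.
move=> jJ nt; have vj := indices_valid jJ.
rewrite -(size_cell nt vj (etrans (size_tuple y) (addnC m n)) (leqnn l)).
split; first by apply: size_cell_elig nt _.
exact/size_subseq/elig_subseq.
Qed.

Lemma npts_le n j i : j \in J -> (i <= l)%N -> (npts p n j i <= n)%N.
Proof.
move=> jJ; elim: i => //= i IH il; apply: leq_trans (IH (ltnW il)).
rewrite -[leqRHS](rk_last p n j i); apply: leq_trans (leq_subr _ _) _.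
by apply: (leq_rk p n j i (s := (nth 0%N j i).+1)); rewrite ltnS; exact: (indices_valid jJ).
Qed.

Definition sect n j (x : n.-tuple X) : R := sectionr mu (@region_graph R k a b p n j) x.

Lemma chi2_moment_le rmin n : (forall j, j \in J -> rmin <= r j) -> 0 < rmin ->
  (0 < n)%N -> l.+1%:R <= n%:R * rmin ->
  (\sum_(j <- J) \int[iid_law mu n]_x ((2 * r j)^-1 * sect j x ^+ 2)%:E <=
   (1 / 2 + (size J - 1)%N%:R / (2 * n%:R) +
    (size J)%:R * (((2 * l + 2) * (2 * l + 3))%N%:R / rmin) / n%:R ^+ 2)%:E)%E.
Proof.
move=> rminP r0 n0 hn.
have rj0 j : 0 < r j by exact: share_gt0.
have [B BE] : exists B, (2 * l + 2 = B)%N by exists (2 * l + 2)%N.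
have -> : (2 * l + 3 = B.+1)%N by lia.
(* [B = 2 l + 2] bounds the deviation [eta] of an eligible count from [n r_j]: [l] for the floors,
   [l] for the discarded endpoints, 2 for the added points. So [B (B + 1)] bounds
   [eta ^ 2 - eta]. *)
rewrite BE; set C0 : R := (B * B.+1)%N%:R / rmin.
set L : R := (size J)%:R.
have C00 : 0 <= C0 by rewrite divr_ge0 // ltW.
have nR : 0 < n%:R :> R by rewrite ltr0n.
have L1 : 1 <= L.
  rewrite /L ler1n lt0n; apply/eqP => /size0nil J0.
  by have := sum_share R p l; rewrite J0 big_nil => /eqP; rewrite eq_sym oner_eq0.
(* Twice [K] is the sum of [n ^ 2 r_j + 2 n eta_j - n + C0] over the [L] regions, with the sum of
   the [eta_j] replaced by its bound [1 + L]. *)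
pose K : R := (n%:R ^+ 2 + n%:R * (L + 2) + L * C0) / 2.
apply: (@le_trans _ _ (K / ((2 + n) ^_ 2)%:R)%:E); last first.
  rewrite lee_fin ffactnS ffactn1 natrM.
  have -> : (2 + n)%:R = n%:R + 2 :> R by rewrite natrD addrC.
  have -> : (2 + n).-1%:R = n%:R + 1 :> R by rewrite add2n /= -natr1.
  rewrite natrB -/L; last by rewrite -(ler1n R).
  rewrite ler_pdivrMr ?mulr_gt0 ?addr_gt0 // /K -subr_ge0.
  have -> : (1 / 2 + (L - 1) / (2 * n%:R) + L * C0 / n%:R ^+ 2) * ((n%:R + 2) * (n%:R + 1)) -
     (n%:R ^+ 2 + n%:R * (L + 2) + L * C0) / 2 =
     1 + 3 * (L - 1) / 2 + (L - 1) / n%:R + L * C0 / 2 + L * C0 * (3 * n%:R + 2) / n%:R ^+ 2.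
    by field; rewrite gt_eqF.
  have L0 : 0 <= L - 1 by rewrite subr_ge0.
  have LC0 : 0 <= L * C0 by rewrite mulr_ge0 // (le_trans ler01).
  have n0' := ltW nR.
  have t1 : 0 <= 3 * (L - 1) / 2 by rewrite divr_ge0 // mulr_ge0.
  have t2 : 0 <= (L - 1) / n%:R by rewrite divr_ge0.
  have t3 : 0 <= L * C0 / 2 by rewrite divr_ge0.
  have t4 : 0 <= L * C0 * (3 * n%:R + 2) / n%:R ^+ 2.
    by rewrite divr_ge0 ?exprn_ge0 // mulr_ge0 // addr_ge0 // mulr_ge0.
  by rewrite !addr_ge0.
apply: (@moment_le _ _ _ a b p lk mu mu_cont 2 n (fun j => (2 * r j)^-1)).
- by move=> j; rewrite invr_ge0 mulr_ge0 ?ltW.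
- by move=> j i jJ il; exact: (npts_large jJ rminP r0 hn il).
- move=> y nt.
  pose u j : R := (size (elig (@coord R k) p n 2 j y l))%:R.
  have su : \sum_(j <- J) u j <= n%:R + 1 + L.
    have := sum_size_elig p n 2 nt (leqnn l).
    rewrite /= mul1n size_tuple -(ler_nat R) !natrD natr_sum /u /L.
    by lra.
  apply: (@le_trans _ _ (\sum_(j <- J)
     (n%:R ^+ 2 * r j + 2 * n%:R * (u j - n%:R * r j) - n%:R + C0) / 2)).
    rewrite big_seq [leRHS]big_seq; apply: ler_sum => j jJ.
    have [e1 e2] := size_elig_bounds jJ nt.
    have -> : (size (elig (@coord R k) p n 2 j y l) ^_ 2)%:R = u j * (u j - 1).
      rewrite ffactnS ffactn1 natrM /u; case: (size _) => [|v]; first by rewrite !mul0r.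
      by rewrite -[v.+1%:R]natr1 addrK.
    have e3 : `|u j - n%:R * r j| <= B%:R.
      have := npts_share R p n j l; move: e1 e2; rewrite -!(ler_nat R) !natrD -/(u j).
      by rewrite !ler_norml -BE ?natrD ?natrM => ? ? /andP[? ?]; apply/andP; split; lra.
    move: (rminP j jJ) (rj0 j) e3; move: (r j) => rj rjm rjp.
    set eta := u j - n%:R * rj => e3.
    have -> : u j = n%:R * rj + eta by rewrite /eta addrC subrK.
    have -> : (2 * rj)^-1 * ((n%:R * rj + eta) * (n%:R * rj + eta - 1)) =
      (n%:R ^+ 2 * rj + 2 * n%:R * eta - n%:R + (eta ^+ 2 - eta) / rj) / 2.
      by field; rewrite gt_eqF.
    rewrite ler_pM2r ?invr_gt0 // lerD2l.
    apply: (@le_trans _ _ ((B * B.+1)%N%:R / rj)).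
      rewrite ler_pM2r ?invr_gt0 //.
      have : eta ^+ 2 <= B%:R ^+ 2 by rewrite -(real_normK (num_real eta)) lerXn2r ?nnegrE.
      move: e3; rewrite ler_norml natrM -natr1 expr2 => /andP[e4 e5] e6.
      by rewrite [leRHS]mulrDr mulr1 -[B%:R * _]expr2; move: e4 e6; lra.
    by rewrite ler_wpM2l // lef_pV2 ?posrE.
  rewrite -mulr_suml ler_pM2r ?invr_gt0 // !big_split /= -!mulr_sumr sumrB -mulr_sumr.
  rewrite sum_share sumrN !big_const_seq !count_predT !iter_addr_0 -[n%:R *+ _]mulr_natr.
  rewrite -[rmin^-1 *+ _]mulr_natl -/L !mulr1 [_ * (L * _)]mulrCA -/C0.
  have : 2 * n%:R * (\sum_(j <- J) u j - n%:R) <= 2 * n%:R * (1 + L).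
    by rewrite ler_wpM2l ?mulr_ge0 ?(ltW nR) //; move: su; lra.
  by lra.
- have L0 : 0 <= L by rewrite ler0n.
  have h1 : 0 <= n%:R ^+ 2 :> R by rewrite exprn_ge0.
  have h2 : 0 <= n%:R * (L + 2) by rewrite mulr_ge0 // addr_ge0.
  have h3 : 0 <= L * C0 by rewrite mulr_ge0.
  by rewrite /K; move: h1 h2 h3; lra.
Qed.

End Moments.

(** * High moments and the mean squared Hellinger distance *)

Section HellingerMoment.
Variables (R : realType) (k l : nat) (a b : k.-tuple (\bar R)) (p : seq nat -> nat).
Hypothesis lk : (0 < l <= k)%N.
Variable mu : probability (k.-tuple R) R.
Hypothesis mu_box : mu (box a b) = 1%E.
Hypothesis mu_cont : continuous_distribution mu.
Local Notation X := (k.-tuple R).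
Local Notation J := (indices p l).
Local Notation r := (@share R p l).
Local Notation sect := (@sect R k a b p mu _).

(** Factor by factor: lowering numerator and denominator of a fraction at most 1 by the same amount
    does not increase it. *)
Lemma ffact_ratio N n e : (N <= n)%N ->
  ((N + e) ^_ e * (e + n) ^ e <= (N + e) ^ e * (e + n) ^_ e)%N.
Proof.
move=> Nn; have powE x : (x ^ e = \prod_(i < e) x)%N by rewrite prod_nat_const card_ord.
rewrite !ffact_prod !powE -!big_split /=; apply: leq_prod => i _.
move: (ltnW (ltn_ord i)); move: (nat_of_ord i) => v ve.
have [d ->] : exists d, (e = v + d)%N by exists (e - v)%N; rewrite subnKC.
have -> : (N + (v + d) - v = N + d)%N by lia.
have -> : (v + d + n - v = n + d)%N by lia.
nia.
Qed.

Lemma measurable_sect n j : measurable_fun setT (@sectionr _ X R mu n (region_graph a b p j)).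
Proof. by apply: measurable_sectionr; exact: measurable_region_graph (leqnn _). Qed.

Lemma tail_moment_le rmin n e : (forall j, j \in J -> rmin <= r j) -> 0 < rmin -> rmin <= 1 ->
  (0 < n)%N -> (l.+1 + e)%:R <= n%:R * (rmin / 4 * rmin) ->
  (\sum_(j <- J) \int[iid_law mu n]_x
     (2 * (((1 + rmin / 2) * r j) ^- e * sect j x ^+ e))%:E <=
   (2 * (size J)%:R * (16 / rmin / e.+1%:R) ^+ 2)%:E)%E.
Proof.
move=> rminP r0 r1 n0 hn; set c := rmin / 2.
have c0 : 0 < c by rewrite divr_gt0.
have c1 : 0 < 1 + c by rewrite addr_gt0.
have rj0 j : 0 < r j by exact: share_gt0.
have nR : 0 < n%:R :> R by rewrite ltr0n.
have cr0 j : 0 < (1 + c) * r j by rewrite mulr_gt0.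
set w := fun j => 2 * ((1 + c) * r j) ^- e.
have w0 j : 0 <= w j by rewrite mulr_ge0 // invr_ge0 exprn_ge0 // ltW.
under eq_bigr => j _ do under eq_integral => x _ do rewrite mulrA -/(w j).
have hn' : l.+1%:R <= n%:R * rmin.
  have h4 : n%:R * (rmin / 4 * rmin) <= n%:R * rmin.
    by rewrite ler_pM2l // ler_piMl ?(ltW r0) //; move: r0 r1; lra.
  apply: le_trans h4; apply: le_trans hn.
  by rewrite ler_nat leq_addr.
pose K : R := \sum_(j <- J) w j * ((npts p n j l + e) ^_ e)%:R.
have eN0 : 0 < ((e + n) ^_ e)%:R :> R by rewrite ltr0n ffact_gt0 leq_addr.
apply: (@le_trans _ _ (K / ((e + n) ^_ e)%:R)%:E).
  apply: (@moment_le _ _ _ a b p lk mu mu_cont e n w K) => //.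
  - by move=> j i jJ il; exact: (npts_large lk jJ rminP r0 hn' il).
  - move=> y nt; rewrite big_seq [leRHS]big_seq; apply: ler_sum => j jJ.
    rewrite ler_wpM2l // ler_nat; apply: leq_ffact2.
    by have [] := size_elig_bounds jJ nt.
  - by apply: sumr_ge0 => j _; rewrite mulr_ge0.
rewrite lee_fin /K mulr_suml; set Q := (16 / rmin / e.+1%:R) ^+ 2.
have -> : 2 * (size J)%:R * Q = \sum_(j <- J) 2 * Q.
  by rewrite big_const_seq count_predT iter_addr_0 -[RHS]mulr_natl [RHS]mulrCA mulrA.
rewrite big_seq [leRHS]big_seq; apply: ler_sum => j jJ.
(* The value makes [(1 + rmin / 4) (1 + tau) ^ 2 <= 1 + rmin / 2], so each of the [e] factors of the
   moment is at most [(1 + tau) ^ -2]. *)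
set tau := rmin / 16; have t0 : 0 < tau by rewrite divr_gt0.
set N := npts p n j l.
have eN1 : 0 < (e + n)%:R :> R by rewrite ltr0n addn_gt0 n0 orbT.
have ratio : ((N + e) ^_ e)%:R / ((e + n) ^_ e)%:R <= ((N + e)%:R / (e + n)%:R) ^+ e :> R.
  rewrite expr_div_n ler_pdivrMr // mulrAC ler_pdivlMr ?exprn_gt0 // -!natrX -!natrM ler_nat.
  by apply: ffact_ratio; exact: (npts_le n jJ (leqnn l)).
(* This weak form of Bernoulli's inequality gives up the exponential decay: after squaring, a bound
   of order [e ^ -2] remains, which matches the other error terms. *)
have bern : tau * e.+1%:R <= (1 + tau) ^+ e.
  have t1 : tau <= 1 by rewrite /tau; move: r0 r1; lra.
  elim: (e) => [|v IH]; first by rewrite mulr1 expr0.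
  rewrite exprS mulrDl mul1r -[v.+2%:R]natr1 mulrDr mulr1 lerD //.
  by rewrite ler_peMr ?(ltW t0) // exprn_ege1 // lerDl ltW.
have step : (N + e)%:R / (e + n)%:R / ((1 + c) * r j) <= ((1 + tau) ^+ 2)^-1.
  have := npts_share R p n j l; rewrite ler_norml -/N => /andP[_ hN].
  have h5 : n%:R * (rmin / 4 * rmin) <= n%:R * (rmin / 4 * r j).
    by rewrite ler_pM2l // ler_pM2l ?divr_gt0 // rminP.
  have h6 : (N + e)%:R <= n%:R * r j * (1 + rmin / 4) :> R.
    move: hn hN h5; rewrite !natrD -[l.+1%:R]natr1.
    have -> : n%:R * r j * (1 + rmin / 4) = n%:R * r j + n%:R * (rmin / 4 * r j) by ring.
    by lra.
  rewrite -mulrA -invfM ler_pdivrMr ?mulr_gt0 // mulrC ler_pdivlMr; last first.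
    by rewrite exprn_gt0 // addr_gt0.
  apply: (@le_trans _ _ (n%:R * r j * (1 + rmin / 4) * (1 + tau) ^+ 2)).
    by rewrite ler_wpM2r // exprn_ge0 // addr_ge0 // ltW.
  apply: (@le_trans _ _ (n%:R * r j * (1 + c))); last first.
    rewrite -mulrA [r j * _]mulrC ler_pM2r ?mulr_gt0 //.
    by rewrite natrD lerDr.
  rewrite -mulrA ler_pM2l ?mulr_gt0 // /c /tau.
  rewrite -subr_ge0.
  have -> : 1 + rmin / 2 - (1 + rmin / 4) * (1 + rmin / 16) ^+ 2 =
    rmin / 8 * (1 - rmin * (9 / 32) - rmin ^+ 2 / 128) by field.
  rewrite mulr_ge0 ?divr_ge0 ?(ltW r0) //.
  have : rmin ^+ 2 <= 1 by rewrite expr_le1 // ltW.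
  by move: r0 r1; lra.
have -> : w j * ((N + e) ^_ e)%:R / ((e + n) ^_ e)%:R =
    2 * (((N + e) ^_ e)%:R / ((e + n) ^_ e)%:R / ((1 + c) * r j) ^+ e).
  by rewrite /w -!mulrA; congr (2 * _); rewrite mulrC -mulrA.
rewrite ler_pM2l //.
apply: (@le_trans _ _ (((N + e)%:R / (e + n)%:R / ((1 + c) * r j)) ^+ e)).
  by rewrite [leRHS]expr_div_n ler_wpM2r // invr_ge0 exprn_ge0 // ltW.
apply: (@le_trans _ _ (((1 + tau) ^+ 2)^-1 ^+ e)).
  apply: lerXn2r; rewrite ?nnegrE //.
    by rewrite divr_ge0 ?divr_ge0 // ltW.
  by rewrite invr_ge0 exprn_ge0 // addr_ge0 // ltW.
have t2 : 0 < 1 + tau by rewrite addr_gt0.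
have te : 0 < tau * e.+1%:R by rewrite mulr_gt0.
have -> : Q = ((tau * e.+1%:R) ^+ 2)^-1.
  by rewrite /Q /tau -exprVn; congr (_ ^+ 2); field; rewrite nat1r pnatr_eq0 /= gt_eqF.
rewrite exprVn lef_pV2 ?posrE ?exprn_gt0 // exprAC.
by apply: lerXn2r; rewrite ?nnegrE ?exprn_ge0 // ltW.
Qed.

Definition hellinger n (x : n.-tuple X) : R :=
  \sum_(j <- J) (Num.sqrt (sect j x) - Num.sqrt (r j)) ^+ 2.

Lemma sect_ge0 n j (x : n.-tuple X) : 0 <= sect j x.
Proof. exact: sectionr_ge0. Qed.

Lemma sum_sect n (x : n.-tuple X) : \sum_(j <- J) sect j x = 1.
Proof.
have lk' : (l <= k)%N by case/andP: lk.
rewrite -(sum_discretized p lk' mu_box mu_cont x).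
by apply: eq_bigr => j _; rewrite discretized_sectionr.
Qed.

Lemma measurable_sectX n j e : measurable_fun [set: n.-tuple X] (fun x => sect j x ^+ e).
Proof. by apply: measurable_funX; exact: measurable_sect. Qed.

Lemma measurable_hellinger n : measurable_fun [set: n.-tuple X] (@hellinger n).
Proof.
apply: measurable_sum => j; apply: measurable_funX; apply: measurable_funB => //.
apply: measurableT_comp; last exact: measurable_sect.
exact: continuous_measurable_fun (@sqrt_continuous R).
Qed.

Lemma hellinger_ge0 n (x : n.-tuple X) : 0 <= hellinger x.
Proof. by apply: sumr_ge0 => j _; exact: sqr_ge0. Qed.

Lemma hellinger_moment_le : exists C : R, 0 <= C /\ exists n0, forall n, (n0 <= n)%N ->
  (\int[iid_law mu n]_x (hellinger x)%:E <=
   ((size J - 1)%N%:R / (2 * n%:R) + C / n%:R ^+ 2)%:E)%E.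
Proof.
have [rmin /andP[r0 r1] rminP] := share_min R l p.
(* Half of the room [rmin ^ 2 / 4] granted by [tail_moment_le]: one half pays for [l + 1], the other
   for the order [e]. *)
pose delta := rmin / 4 * rmin / 2.
have d0 : 0 < delta by rewrite /delta !mulr_gt0.
pose M := (Num.trunc delta^-1).+1; set L : R := (size J)%:R.
have M1 : delta^-1 <= M%:R by rewrite ltW // truncnS_gt.
have M0 : 0 < M%:R :> R by rewrite ltr0n.
pose C0 : R := ((2 * l + 2) * (2 * l + 3))%N%:R / rmin.
pose C := L * C0 + 2 * L * (16 / rmin * M%:R) ^+ 2.
exists C; split.
  by rewrite addr_ge0 ?mulr_ge0 ?exprn_ge0 ?divr_ge0 ?mulr_ge0 ?invr_ge0 // ltW.
exists (Num.trunc (l.+1%:R / delta)).+1 => n n0.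
have n1 : (0 < n)%N by exact: leq_trans n0.
have nR : 0 < n%:R :> R by rewrite ltr0n.
have ln : l.+1%:R <= n%:R * delta.
  rewrite -ler_pdivrMr //; apply: le_trans (ltW (truncnS_gt _)) _.
  by rewrite ler_nat.
(* The order is proportional to [n], and [(e + 1) M >= n] turns the tail bound into a multiple of
   [n ^ -2]. *)
pose e := (n %/ M)%N.
have en : e%:R <= n%:R * delta.
  apply: (@le_trans _ _ (n%:R / M%:R)).
    by rewrite ler_pdivlMr // -natrM ler_nat leq_divM.
  by rewrite ler_pM2l // -[delta]invrK lef_pV2 ?posrE // invr_gt0.
have ne : n%:R <= e.+1%:R * M%:R :> R.
  by rewrite -natrM ler_nat ltnW // ltn_ceil.
have hn : (l.+1 + e)%:R <= n%:R * (rmin / 4 * rmin).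
  have -> : rmin / 4 * rmin = delta + delta by rewrite /delta; field.
  by rewrite natrD mulrDr lerD.
have hn' : l.+1%:R <= n%:R * rmin.
  apply: le_trans ln _; rewrite ler_pM2l // /delta.
  have : rmin * rmin <= rmin * 1 by rewrite ler_pM2l.
  by move: r0; lra.
have chi := chi2_moment_le a b lk mu_cont rminP r0 n1 hn'.
have tail := tail_moment_le rminP r0 r1 n1 hn.
have mchi j : measurable_fun [set: n.-tuple X] (fun x => ((2 * r j)^-1 * sect j x ^+ 2)%:E).
  by apply/measurable_EFinP/measurable_funM => //; exact: measurable_sectX.
have mtail j : measurable_fun [set: n.-tuple X]
    (fun x => (2 * (((1 + rmin / 2) * r j) ^- e * sect j x ^+ e))%:E).
  apply/measurable_EFinP/measurable_funM => //; apply: measurable_funM => //.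
  exact: measurable_sectX.
have w0 j : 0 <= ((1 + rmin / 2) * r j) ^- e.
  by rewrite invr_ge0 exprn_ge0 // mulr_ge0 ?(ltW (share_gt0 _ _ _ _)) // addr_ge0 // divr_ge0 // ltW.
have chi0 j (x : n.-tuple X) : (0 <= ((2 * r j)^-1 * sect j x ^+ 2)%:E)%E.
  by rewrite lee_fin mulr_ge0 ?sqr_ge0 // invr_ge0 mulr_ge0 // ltW // share_gt0.
have tail0 j (x : n.-tuple X) :
    (0 <= (2 * (((1 + rmin / 2) * r j) ^- e * sect j x ^+ e))%:E)%E.
  by rewrite lee_fin !mulr_ge0 // exprn_ge0 // sect_ge0.
have mH : measurable_fun [set: n.-tuple X] (fun x => (hellinger x)%:E).
  by apply/measurable_EFinP; exact: measurable_hellinger.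
(* The [1 / 2] stays on the left, so that only nonnegative functions are integrated and no
   integrability has to be checked. *)
have main : (\int[iid_law mu n]_x (hellinger x)%:E + (1 / 2)%:E <=
    (1 / 2 + (size J - 1)%N%:R / (2 * n%:R) + L * C0 / n%:R ^+ 2)%:E +
    (2 * L * (16 / rmin / e.+1%:R) ^+ 2)%:E)%E.
  apply: le_trans (leeD chi tail).
  rewrite -!ge0_integral_sum //.
  rewrite -ge0_integralD //; last first.
  - exact: emeasurable_sum.
  - by move=> x _; apply: sume_ge0 => j _; exact: tail0.
  - exact: emeasurable_sum.
  - by move=> x _; apply: sume_ge0 => j _; exact: chi0.
  have -> : (1 / 2)%:E = (\int[iid_law mu n]_x (cst (1 / 2)%:E x))%E.
    by rewrite integral_cst // [X in (_ * X)%E]probability_setT mule1.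
  rewrite -ge0_integralD //; last 2 first.
  - by move=> x _; rewrite lee_fin hellinger_ge0.
  - by move=> x _; rewrite lee_fin divr_ge0.
  apply: ge0_le_integral => //.
  - by move=> x _; rewrite adde_ge0 ?lee_fin ?hellinger_ge0.
  - exact: emeasurable_funD.
  - by apply: emeasurable_funD; exact: emeasurable_sum.
  move=> x _; rewrite !sumEFin -!EFinD lee_fin.
  apply: hellinger_le => //; first by move=> j; exact: sect_ge0.
    exact: sum_sect.
  exact: sum_share.
move: main; rewrite -EFinD -leeBrDr // -EFinB => /le_trans; apply.
rewrite lee_fin.
have h : (16 / rmin / e.+1%:R) ^+ 2 <= (16 / rmin * M%:R) ^+ 2 / n%:R ^+ 2.
  rewrite -expr_div_n; apply: lerXn2r; rewrite ?nnegrE ?divr_ge0 ?mulr_ge0 ?invr_ge0 ?(ltW r0) //.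
  rewrite -[leRHS]mulrA ler_pM2l ?divr_gt0 // ler_pdivlMr // mulrC ler_pdivrMr //.
  by rewrite mulrC.
have L0 : 0 <= 2 * L by rewrite mulr_ge0.
have -> : C / n%:R ^+ 2 =
    L * C0 / n%:R ^+ 2 + 2 * L * ((16 / rmin * M%:R) ^+ 2 / n%:R ^+ 2).
  by rewrite /C mulrDl -[X in _ + X]mulrA.
have := ler_wpM2l L0 h; move: (2 * L * _) (2 * L * _) (L * C0 / _) => A1 A2 A3.
by lra.
Qed.

End HellingerMoment.

(** * Comparison of the divergences *)

Section SampleLaws.
Context d (T : measurableType d) d' (Omega : measurableType d') (R : realType).
Variable P : probability Omega R.

Lemma measurable_sample n (X : 'I_n -> {RV P >-> T}) :
  measurable_fun [set: Omega] (sample X).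
Proof.
apply/measurable_fun_tnthP => i; rewrite (_ : _ \o _ = X i); first exact: measurable_funP.
by apply/funext => w /=; rewrite tnth_mktuple.
Qed.

Lemma iid_sample_law n (X : 'I_n -> {RV P >-> T}) (mu : probability T R) :
  iid X mu -> forall A, measurable A -> P (sample X @^-1` A) = iid_law mu n A.
Proof.
move=> [ind lawX].
pose S : {mfun Omega >-> n.-tuple T} :=
  HB.pack (sample X) (isMeasurableFun.Build _ _ _ _ _ (measurable_sample X)).
move=> A mA; rewrite -[LHS]/(distribution P S A); apply: iid_law_unique => // B mB.
rewrite -[LHS]/(P (sample X @^-1` rect B)).
have := ind [set: 'I_n]%SET B mB.
rewrite (eq_bigl xpredT); last by move=> i; rewrite finset.in_setT.
under eq_bigr => i _ do rewrite -[P _]/(distribution P (X i) (B i)) lawX //.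
move=> <-; congr (P _); apply/seteqP; split => w /= h i.
  by move=> _; have := h i; rewrite tnth_mktuple.
by rewrite tnth_mktuple; apply: h; rewrite finset.in_setT.
Qed.

(** The second sample is integrated outside: given it, the regions are fixed sets, and Jensen's
    inequality concerns the inner integral. *)
Lemma samples_integral n1 n2 (X1 : 'I_n1 -> {RV P >-> T}) (X2 : 'I_n2 -> {RV P >-> T})
    (mu1 mu2 : probability T R) (f : n1.-tuple T * n2.-tuple T -> \bar R) :
  iid X1 mu1 -> iid X2 mu2 -> independent_samples X1 X2 ->
  measurable_fun [set: n1.-tuple T * n2.-tuple T] f -> (forall z, 0 <= f z)%E ->
  (\int[P]_w f (sample X1 w, sample X2 w) =
   \int[iid_law mu2 n2]_x2 \int[iid_law mu1 n1]_x1 f (x1, x2))%E.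
Proof.
move=> iid1 iid2 ind mf f0.
have mS : measurable_fun [set: Omega] (fun w => (sample X1 w, sample X2 w)).
  by apply: measurable_fun_pair; exact: measurable_sample.
pose S : {mfun Omega >-> (n1.-tuple T * n2.-tuple T)%type} :=
  HB.pack (fun w => (sample X1 w, sample X2 w)) (isMeasurableFun.Build _ _ _ _ _ mS).
rewrite -[LHS](ge0_integral_distribution S) // -[RHS]/(\int[_]_x fubini_G _ _ x)%E.
rewrite -fubini_tonelli2 //; apply: eq_measure_integral => A mA _; apply/esym.
apply: product_measure_unique => // B C mB mC.
apply: etrans (ind _ _ mB mC) _.
by congr (_ * _)%E; [exact: (iid_sample_law iid1)|exact: (iid_sample_law iid2)].
Qed.

End SampleLaws.

Section Jensen.
Context d (T : measurableType d) (R : realType).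
Variable mu : probability T R.

Definition frequency n (A : set T) (x : n.-tuple T) : R :=
  (\sum_(i < n) \1_A (tnth x i)) / n%:R.

Lemma frequency_ge0 n A (x : n.-tuple T) : 0 <= frequency A x.
Proof. by rewrite divr_ge0 // sumr_ge0 // => i _; rewrite indicE. Qed.

Lemma measurable_frequency n (A : set T) : measurable A ->
  measurable_fun [set: n.-tuple T] (frequency A).
Proof.
move=> mA; apply: measurable_funM => //; apply: measurable_sum => i.
by apply: measurableT_comp; [exact: measurable_indic|exact: measurable_tnth].
Qed.

Lemma integral_frequency n (A : set T) : (0 < n)%N -> measurable A ->
  (\int[iid_law mu n]_x (frequency A x)%:E = mu A)%E.
Proof.
move=> n0 mA.
have mi i : measurable_fun [set: n.-tuple T] (fun x => (\1_A (tnth x i) : R)%:E).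
  apply/measurable_EFinP.
  by apply: measurableT_comp; [exact: measurable_indic|exact: measurable_tnth].
transitivity (\int[iid_law mu n]_x
   (n%:R^-1%:E * \sum_(i < n) (\1_A (tnth x i))%:E))%E.
  by apply: eq_integral => x _; rewrite sumEFin -EFinM mulrC.
rewrite ge0_integralZl_EFin ?invr_ge0 //; last 2 first.
- by move=> x _; apply: sume_ge0 => i _; rewrite lee_fin indicE.
- exact: emeasurable_sum.
rewrite ge0_integral_sum //.
rewrite (eq_bigr (fun=> mu A)); last first.
  move=> i _; rewrite -(iid_law_tnth mu i mA) -[X in iid_law mu n X]setIT -integral_indic //.
  by rewrite -[X in measurable X]setTI; exact: measurable_tnth.
transitivity (n%:R^-1%:E * (n%:R%:E * mu A))%E.
  by congr (_ * _)%E; rewrite big_const_ord iter_addr_0 mule_natl.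
rewrite muleA -EFinM mulVf ?mul1e //.
by rewrite pnatr_eq0 -lt0n.
Qed.

(* The concavity of the square root is used through its tangents
   [2 sqrt q <= q / t + t], where [t] decreases to [sqrt (mu A)]; the limit takes
   care of [mu A = 0], where the tangent is vertical. *)
Lemma frequency_jensen n (A : set T) (r : R) : (0 < n)%N -> measurable A -> 0 <= r ->
  ((2 * (Num.sqrt (fine (mu A)) - Num.sqrt r) ^+ 2)%:E <=
   \int[iid_law mu n]_x (2 * (Num.sqrt (frequency A x) - Num.sqrt r) ^+ 2)%:E)%E.
Proof.
move=> n0 mA r0; set q := fine (mu A).
have q0 : 0 <= q by exact/fine_ge0/measure_ge0.
have qE : mu A = q%:E by rewrite fineK // fin_num_measure.
set s := Num.sqrt r; have s0 : 0 <= s by exact: sqrtr_ge0.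
have s2 : s ^+ 2 = r by rewrite sqr_sqrtr.
set v := Num.sqrt q; have v0 : 0 <= v by exact: sqrtr_ge0.
have v2 : v ^+ 2 = q by rewrite sqr_sqrtr.
have mf : measurable_fun [set: n.-tuple T] (fun x => (frequency A x)%:E).
  by apply/measurable_EFinP; exact: measurable_frequency.
set I := integral _ _ _.
apply/lee_addgt0Pr => e e0.
(* Taking the tangent at [t] instead of [v] costs [2 s (t - v)], which this step keeps below [e]. *)
pose t := v + e / (2 * s + 1).
have t0 : 0 < t by rewrite ltr_wpDl // divr_gt0 // ltr_wpDl // mulr_ge0.
(* The tangent term is kept on the right so that all integrands are nonnegative; the pointwise gap
   is [2 s / t] times the square of [z - t]. *)
have key : ((2 * q + 2 * r)%:E <= I + (2 * s * (q / t + t))%:E)%E.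
  pose g (x : n.-tuple T) : R := 2 * (Num.sqrt (frequency A x) - s) ^+ 2.
  have aff (c1 c2 : R) : 0 <= c1 -> 0 <= c2 ->
      (\int[iid_law mu n]_x (c1 * frequency A x + c2)%:E = (c1 * q + c2)%:E)%E.
    move=> c10 c20.
    transitivity (\int[iid_law mu n]_x (c1%:E * (frequency A x)%:E + cst c2%:E x))%E.
      by apply: eq_integral => x _; rewrite EFinD EFinM.
    rewrite ge0_integralD //; first last.
    - exact: measurable_funeM.
    - by move=> x _; rewrite -EFinM lee_fin mulr_ge0 // frequency_ge0.
    rewrite ge0_integralZl_EFin //; last first.
      by move=> x _; rewrite lee_fin frequency_ge0.
    rewrite integral_frequency // qE integral_cst //.
    rewrite [X in (_ + _ * X)%E]probability_setT.
    by rewrite mule1 -EFinM -EFinD.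
  have mg : measurable_fun [set: n.-tuple T] (fun x => (g x)%:E).
    apply/measurable_EFinP/measurable_funM => //; apply: measurable_funX.
    apply: measurable_funB => //; apply: measurableT_comp; last exact: measurable_frequency.
    exact: continuous_measurable_fun (@sqrt_continuous R).
  have maff c1 c2 : measurable_fun [set: n.-tuple T] (fun x => (c1 * frequency A x + c2)%:E).
    apply/measurable_EFinP/measurable_funD => //; apply: measurable_funM => //.
    exact: measurable_frequency.
  rewrite -(aff 2 (2 * r)) ?mulr_ge0 //.
  have -> : 2 * s * (q / t + t) = 2 * s / t * q + 2 * s * t by ring.
  have st0 : 0 <= 2 * s / t by rewrite divr_ge0 ?mulr_ge0 // ltW.
  have st1 : 0 <= 2 * s * t by rewrite mulr_ge0 ?mulr_ge0 // ltW.
  rewrite -(aff (2 * s / t) (2 * s * t) st0 st1).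
  rewrite /I -ge0_integralD //; last 2 first.
  - by move=> x _; rewrite lee_fin mulr_ge0 // sqr_ge0.
  - move=> x _; rewrite lee_fin; apply: addr_ge0 => //.
    exact: mulr_ge0 st0 (frequency_ge0 _ _).
  apply: ge0_le_integral => //.
  - move=> x _; rewrite lee_fin; apply: addr_ge0; last exact: mulr_ge0.
    by apply: mulr_ge0 => //; exact: frequency_ge0.
  - exact: emeasurable_funD.
  move=> x _; rewrite -EFinD lee_fin.
  have := frequency_ge0 A x; move: (frequency A x) => y y0.
  set z := Num.sqrt y; have z0 : 0 <= z by exact: sqrtr_ge0.
  have <- : z ^+ 2 = y by rewrite sqr_sqrtr.
  rewrite -s2 -subr_ge0.
  have -> : 2 * (z - s) ^+ 2 + (2 * s / t * z ^+ 2 + 2 * s * t) - (2 * z ^+ 2 + 2 * s ^+ 2) =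
    2 * s / t * (z - t) ^+ 2 by field; rewrite gt_eqF.
  by rewrite mulr_ge0 ?sqr_ge0 // divr_ge0 ?mulr_ge0 // ltW.
have {key} : ((2 * q + 2 * r - 2 * s * (q / t + t))%:E <= I)%E.
  by rewrite EFinB leeBlDr.
move=> /(leeD2r e%:E); apply: le_trans; rewrite -EFinD lee_fin.
have qt : q / t <= v.
  rewrite ler_pdivrMr // -v2 expr2; apply: ler_wpM2l => //; rewrite /t lerDl.
  by rewrite divr_ge0 ?(ltW e0) // addr_ge0 // mulr_ge0.
have te : 2 * s * (q / t + t) <= 4 * s * v + e.
  apply: (@le_trans _ _ (2 * s * (v + t))); first by apply: ler_wpM2l; [exact: mulr_ge0|rewrite lerD2r].
  have -> : 2 * s * (v + t) = 4 * s * v + 2 * s / (2 * s + 1) * e.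
    by rewrite /t; field; rewrite gt_eqF // ltr_wpDl // mulr_ge0.
  rewrite lerD2l ler_piMl ?(ltW e0) // ler_pdivrMr ?mul1r ?lerDl //.
  by rewrite ltr_wpDl // mulr_ge0.
rewrite sqrrB s2 v2 -[v * s *+ 2]mulr_natl; move: te.
have -> : 4 * s * v = 4 * (v * s) by ring.
by move: (v * s) (q / t + t) => A1 A2; lra.
Qed.

End Jensen.

(** The Cauchy-Schwarz inequality in linearized form: [4 x (y - z) <= 2 s x ^ 2 + (2 / s) (z - y) ^
    2]. The bound is linear in the squared distance, so it can be integrated with a constant [s], to
    be optimized against the mean afterwards. *)
Lemma divergence_perturb_le (R : realType) (J : seq (seq nat)) (q m r : seq nat -> R) (s : R) :
  0 < s -> (forall j, 0 <= q j) -> (forall j, 0 <= m j) -> (forall j, 0 <= r j) ->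
  \sum_(j <- J) q j = 1 -> \sum_(j <- J) m j = 1 -> \sum_(j <- J) r j = 1 ->
  divergence J q m <= divergence J q r +
    (2 * s + 2 / s * \sum_(j <- J) (Num.sqrt (m j) - Num.sqrt (r j)) ^+ 2).
Proof.
move=> s0 q0 m0 r0 sq sm sr; rewrite /divergence.
have expand (u v : seq nat -> R) : (forall j, 0 <= u j) -> (forall j, 0 <= v j) ->
    2 * \sum_(j <- J) (Num.sqrt (u j) - Num.sqrt (v j)) ^+ 2 =
    2 * \sum_(j <- J) u j + 2 * \sum_(j <- J) v j -
    4 * \sum_(j <- J) Num.sqrt (u j) * Num.sqrt (v j).
  move=> u0 v0; rewrite !mulr_sumr -big_split -sumrB; apply: eq_bigr => j _ /=.
  by rewrite sqrrB !sqr_sqrtr //; ring.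
rewrite (expand q m) // (expand q r) // sq sm sr.
have : 4 * \sum_(j <- J) Num.sqrt (q j) * (Num.sqrt (r j) - Num.sqrt (m j)) <=
    2 * s + 2 / s * \sum_(j <- J) (Num.sqrt (m j) - Num.sqrt (r j)) ^+ 2.
  have -> : 2 * s = \sum_(j <- J) 2 * s * q j by rewrite -mulr_sumr sq mulr1.
  rewrite !mulr_sumr -big_split; apply: ler_sum => j _ /=.
  rewrite -{2}[q j]sqr_sqrtr //; set x := Num.sqrt (q j).
  set y := Num.sqrt (r j); set z := Num.sqrt (m j).
  rewrite -subr_ge0.
  have -> : 2 * s * x ^+ 2 + 2 / s * (z - y) ^+ 2 - 4 * (x * (y - z)) =
    2 / s * (s * x - (y - z)) ^+ 2 by field; rewrite gt_eqF.
  by rewrite mulr_ge0 ?sqr_ge0 // divr_ge0 // ltW.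
under eq_bigr => j _ do rewrite mulrBr.
by rewrite sumrB; lra.
Qed.

Lemma empirical_frequency (R : realType) (k n : nat) (x : n.-tuple (k.-tuple R))
    (A : seq nat -> set (k.-tuple R)) j : empirical x A j = frequency R (A j) x.
Proof.
rewrite /empirical /frequency -sum1_count big_tuple big_mkcond natr_sum /=.
by congr (_ / _); apply: eq_bigr => i _; rewrite indicE; case: (_ \in _).
Qed.

Lemma sqrtrD_le (R : realType) (x y : R) : 0 <= x -> 0 <= y ->
  Num.sqrt (x + y) <= Num.sqrt x + Num.sqrt y.
Proof.
move=> x0 y0; rewrite -(@ler_pXn2r _ 2) ?nnegrE ?addr_ge0 ?sqrtr_ge0 //.
rewrite sqr_sqrtr ?addr_ge0 // sqrrD !sqr_sqrtr // lerD2r lerDl.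
by rewrite mulrn_wge0 // mulr_ge0 ?sqrtr_ge0.
Qed.

(** Since [h <= s ^ 2], the error is at most [4 s], and [4 sqrt (L / (2 n)) = sqrt (8 L) / sqrt n].
    Taking [C + 1] in place of [C] keeps [s] positive even if [L] and [C] vanish. *)
Lemma sqrt_error_le (R : realType) (L C n h : R) : 0 <= L -> 0 <= C -> 0 < n ->
  h = L / (2 * n) + C / n ^+ 2 ->
  let s := Num.sqrt (L / (2 * n) + (C + 1) / n ^+ 2) in
  0 < s /\
  2 * s + 2 / s * h <= Num.sqrt (8 * L) / Num.sqrt n + 4 * Num.sqrt (C + 1) / n.
Proof.
move=> L0 C0 n0 hE s.
have x0 : 0 <= L / (2 * n) by rewrite divr_ge0 // mulr_ge0 // ltW.
have y0 : 0 < (C + 1) / n ^+ 2 by rewrite divr_gt0 ?exprn_gt0 // ltr_wpDl.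
have s0 : 0 < s by rewrite sqrtr_gt0 ltr_wpDl.
split=> //; apply: (@le_trans _ _ (4 * s)).
  have hs : h <= s ^+ 2.
    rewrite sqr_sqrtr ?addr_ge0 ?(ltW y0) // hE lerD2l ler_pM2r ?invr_gt0 ?exprn_gt0 //.
    by rewrite lerDl.
  have : 2 / s * h <= 2 / s * s ^+ 2 by rewrite ler_pM2l // divr_gt0.
  have -> : 2 / s * s ^+ 2 = 2 * s by field; rewrite gt_eqF.
  by lra.
apply: le_trans (_ : 4 * (Num.sqrt (L / (2 * n)) + Num.sqrt ((C + 1) / n ^+ 2)) <= _).
  by rewrite ler_pM2l // sqrtrD_le // ltW.
have sn : Num.sqrt n ^+ 2 = n by rewrite sqr_sqrtr // ltW.
have sqrtE (u v : R) : 0 <= v -> u = v ^+ 2 -> Num.sqrt u = v.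
  by move=> v0 ->; rewrite sqrtr_sqr ger0_norm.
rewrite (sqrtE (L / (2 * n)) (Num.sqrt (8 * L) / (4 * Num.sqrt n))); last 2 first.
- by rewrite divr_ge0 ?mulr_ge0 ?sqrtr_ge0.
- rewrite expr_div_n exprMn sn sqr_sqrtr ?mulr_ge0 //.
  by field; rewrite gt_eqF.
rewrite (sqrtE ((C + 1) / n ^+ 2) (Num.sqrt (C + 1) / n)); last 2 first.
- by rewrite divr_ge0 ?sqrtr_ge0 ?(ltW n0).
- by rewrite expr_div_n sqr_sqrtr // addr_ge0.
rewrite le_eqVlt; apply/orP; left; apply/eqP; field.
by rewrite !gt_eqF ?sqrtr_gt0.
Qed.


Theorem theorem4 (R : realType) (k l : nat) (hl : (1 <= l <= k)%N)
    (a b : k.-tuple (\bar R))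
    (mother model : probability (k.-tuple R) R)
    (mother_box : mother (box a b) = 1%E)
    (model_box : model (box a b) = 1%E)
    (mother_cont : continuous_distribution mother)
    (model_cont : continuous_distribution model)
    (p : seq nat -> nat) :
  exists e1 e2 : nat -> R,
    e1 =o_\oo (fun n : nat => n%:R^-1 : R) /\
    e2 =o_\oo (fun n : nat => (Num.sqrt n%:R)^-1 : R) /\
    \forall n1 \near \oo & n2 \near \oo,
      forall (d : measure_display) (Omega : measurableType d)
        (P : probability Omega R)
        (X1 : 'I_n1 -> {RV P >-> k.-tuple R})
        (X2 : 'I_n2 -> {RV P >-> k.-tuple R}),
        iid X1 mother -> iid X2 model -> independent_samples X1 X2 ->
        let J := indices p l in
        let A w := region a b p (sample X2 w) in
        ('E_P[fun w => divergence J (discretized mother (A w))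
                                    (discretized model (A w))] <=
         'E_P[fun w => divergence J (empirical (sample X1 w) (A w))
                                    (nominal R p)] +
         (Num.sqrt (8 * (size J - 1)%N%:R) / Num.sqrt n2%:R
            + e1 n1 + e2 n2)%:E)%E.
Proof.
have [C [C0 [n0 hC]]] := hellinger_moment_le p hl model_box model_cont.
set L : R := (size (indices p l) - 1)%N%:R in hC.
pose c : R := 4 * Num.sqrt (C + 1).
(* [c / n] is the second term of [sqrt_error_le], the square root of the [n ^ -2] remainder in the
   mean squared distance. *)
exists (fun=> 0), (fun n => c / n%:R); split.
  apply/eqoP => e e0; exists 0%N => // n _ /=.
  by rewrite normr0 mulr_ge0 // ltW.
split.
  apply/eqoP => e e0; exists (Num.trunc ((c / e) ^+ 2)).+1 => // n /= nB.
  have n0' : 0 < n%:R :> R by rewrite ltr0n (leq_trans _ nB).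
  have c0 : 0 <= c by rewrite mulr_ge0 ?sqrtr_ge0.
  have cn : c / e <= Num.sqrt n%:R.
    rewrite -(@ler_pXn2r _ 2) ?nnegrE ?sqrtr_ge0 ?divr_ge0 ?(ltW e0) //.
    rewrite sqr_sqrtr ?(ltW n0') //; apply: le_trans (ltW (truncnS_gt _)) _.
    by rewrite ler_nat.
  rewrite !ger0_norm ?invr_ge0 ?divr_ge0 ?sqrtr_ge0 //.
  rewrite ler_pdivrMr // -{2}(sqr_sqrtr (ltW n0')) expr2 mulrA divfK ?gt_eqF ?sqrtr_gt0 //.
  by rewrite mulrC -ler_pdivrMr.
exists ([set n | (1 <= n)%N], [set n | (maxn n0 1 <= n)%N]).
  by split; [exists 1%N|exists (maxn n0 1)].
move=> [n1 n2] [n1_gt0 n2_ge].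
have {}n1_gt0 : (0 < n1)%N := n1_gt0.
have /andP[n02 n2_gt0] : (n0 <= n2)%N && (0 < n2)%N by rewrite -geq_max; exact: n2_ge.
move=> d Omega P X1 X2 iid1 iid2 ind; rewrite -[(n1, n2).2]/n2 in X2 iid2 ind *.
rewrite -[(n1, n2).1]/n1 in X1 iid1 ind *.
set J := indices p l; pose A w := region a b p (sample X2 w).
have {}hC := hC n2 n02.
have n2R : 0 < n2%:R :> R by rewrite ltr0n.
have [] := sqrt_error_le (ler0n _ _ : 0 <= L) C0 n2R erefl.
set s := Num.sqrt (_ + _); set h := L / _ + _ in hC * => s0 err.
pose q1 j (x : n2.-tuple (k.-tuple R)) := sectionr mother (region_graph a b p j) x.
pose q2 j (x : n2.-tuple (k.-tuple R)) := sectionr model (region_graph a b p j) x.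
pose F1 (x : n2.-tuple (k.-tuple R)) := divergence J (q1^~ x) (q2^~ x).
pose G (x : n2.-tuple (k.-tuple R)) := divergence J (q1^~ x) (nominal R p).
pose F2 (z : n1.-tuple (k.-tuple R) * n2.-tuple (k.-tuple R)) :=
  divergence J (fun j => frequency R (region a b p z.2 j) z.1) (nominal R p).
have mdiv d' (T : measurableType d') (u v : seq nat -> T -> R) :
    (forall j, measurable_fun setT (u j)) -> (forall j, measurable_fun setT (v j)) ->
    measurable_fun setT (fun x => (divergence J (u^~ x) (v^~ x))%:E).
  move=> mu mv; apply/measurable_EFinP/measurable_funM => //.
  have ms := continuous_measurable_fun (@sqrt_continuous R).
  apply: measurable_sum => j; apply: measurable_funX.
  by apply: measurable_funB; apply: measurableT_comp.
have div0 (u v : seq nat -> R) : 0 <= divergence J u v.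
  by rewrite mulr_ge0 // sumr_ge0 // => j _; exact: sqr_ge0.
have mq1 j : measurable_fun setT (q1 j) by exact: measurable_sect.
have mq2 j : measurable_fun setT (q2 j) by exact: measurable_sect.
have mF1 : measurable_fun setT (fun x => (F1 x)%:E) by exact: mdiv.
have mG : measurable_fun setT (fun x => (G x)%:E) by exact: mdiv.
have mF2 : measurable_fun setT (fun z => (F2 z)%:E).
  apply: mdiv => // j; apply: measurable_funM => //; apply: measurable_sum => i.
  rewrite (_ : (fun z => _) = (fun z : n1.-tuple (k.-tuple R) * n2.-tuple (k.-tuple R) =>
     \1_(region_graph a b p j) (z.2, tnth z.1 i))); last first.
    by apply/funext => z; rewrite !indicE.
  apply: measurableT_comp.
    by apply: measurable_indic; exact: measurable_region_graph (leqnn _).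
  apply: measurable_fun_pair; first exact: measurable_snd.
  by apply: (measurableT_comp (@measurable_tnth _ _ _ i)); exact: measurable_fst.
have E1 : ('E_P[fun w => divergence J (discretized mother (A w)) (discretized model (A w))] =
    \int[iid_law model n2]_x (F1 x)%:E)%E.
  rewrite unlock.
  transitivity (\int[P]_w (fun z => (F1 z.2)%:E) (sample X1 w, sample X2 w))%E.
    apply: eq_integral => w _; congr (_%:E); rewrite /F1 /divergence; congr (_ * _).
    by apply: eq_bigr => j _; rewrite !discretized_sectionr.
  rewrite (samples_integral (f := fun z => (F1 z.2)%:E) iid1 iid2 ind); last 2 first.
  - by apply: (measurableT_comp mF1); exact: measurable_snd.
  - by move=> z; rewrite lee_fin div0.
  apply: eq_integral => x _; apply: etrans (integral_cst _ measurableT (F1 x)%:E) _.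
  by rewrite [X in (_ * X)%E]probability_setT mule1.
have E2 : ('E_P[fun w => divergence J (empirical (sample X1 w) (A w)) (nominal R p)] =
    \int[iid_law model n2]_x2 \int[iid_law mother n1]_x1 (F2 (x1, x2))%:E)%E.
  rewrite unlock -(samples_integral (f := fun z => (F2 z)%:E) iid1 iid2 ind) //; last first.
    by move=> z; rewrite lee_fin div0.
  apply: eq_integral => w _; congr (_%:E); rewrite /F2 /divergence; congr (_ * _).
  by apply: eq_bigr => j _; rewrite empirical_frequency.
rewrite E1 E2.
have jensen : (\int[iid_law model n2]_x (G x)%:E <=
    \int[iid_law model n2]_x2 \int[iid_law mother n1]_x1 (F2 (x1, x2))%:E)%E.
  apply: ge0_le_integral => //.
  - by move=> x _; rewrite lee_fin div0.
  - apply: (measurable_fun_fubini_tonelli_G (m1 := iid_law mother n1) (fun z => (F2 z)%:E)) => //.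
    by move=> z; rewrite lee_fin div0.
  move=> x _; rewrite /G /F2 /divergence /=.
  under [leRHS]eq_integral => y _ do rewrite mulr_sumr -sumEFin.
  rewrite mulr_sumr -sumEFin ge0_integral_sum //; last first.
  - by move=> j y _; rewrite lee_fin mulr_ge0 // sqr_ge0.
  - move=> j; apply/measurable_EFinP/measurable_funM => //.
    apply: measurable_funX; apply: measurable_funB => //; apply: measurableT_comp.
      exact: continuous_measurable_fun (@sqrt_continuous R).
    by apply: measurable_frequency; exact: measurable_region.
  apply: lee_sum => j _; rewrite /q1 /sectionr xsection_region_graph.
  apply: frequency_jensen => //; first exact: measurable_region.
  by rewrite invr_ge0.
have sum1 (mu : probability (k.-tuple R) R) : mu (box a b) = 1%E -> continuous_distribution mu ->
    forall x : n2.-tuple (k.-tuple R),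
    \sum_(j <- J) sectionr mu (region_graph a b p j) x = 1.
  by move=> box1 cont x; exact: (sum_sect p hl box1 cont x).
have shareE j : j \in J -> nominal R p j = share R p l j.
  by move=> /indices_size jl; rewrite share_size jl.
have mH : measurable_fun setT (fun x : n2.-tuple (k.-tuple R) => (hellinger l a b p model x)%:E).
  by apply/measurable_EFinP; exact: measurable_hellinger.
have step : (\int[iid_law model n2]_x (F1 x)%:E <= \int[iid_law model n2]_x (G x)%:E +
    ((2 * s)%:E + (2 / s)%:E * \int[iid_law model n2]_x (hellinger l a b p model x)%:E))%E.
  have s2 : 0 <= 2 / s by rewrite divr_ge0 // ltW.
  have s1 : 0 <= 2 * s by rewrite mulr_ge0 // ltW.
  rewrite -ge0_integralZl_EFin //; last by move=> x _; rewrite lee_fin hellinger_ge0.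
  have -> : ((2 * s)%:E = \int[iid_law model n2]_x (cst (2 * s)%:E x))%E.
    by rewrite integral_cst // [X in (_ * X)%E]probability_setT mule1.
  have mZ : measurable_fun setT (fun x : n2.-tuple (k.-tuple R) =>
      ((2 / s)%:E * (hellinger l a b p model x)%:E)%E) by exact: measurable_funeM.
  have Z0 (x : n2.-tuple (k.-tuple R)) : (0 <= (2 / s)%:E * (hellinger l a b p model x)%:E)%E.
    by rewrite -EFinM lee_fin mulr_ge0 // hellinger_ge0.
  rewrite -ge0_integralD // -ge0_integralD //; last 3 first.
  - by move=> x _; rewrite lee_fin div0.
  - by move=> x _; rewrite adde_ge0 // lee_fin.
  - exact: emeasurable_funD.
  apply: ge0_le_integral => //.
  - by move=> x _; rewrite lee_fin div0.
  - by apply: emeasurable_funD => //; exact: emeasurable_funD.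
  move=> x _; rewrite -EFinM -!EFinD lee_fin.
  have -> : hellinger l a b p model x =
      \sum_(j <- J) (Num.sqrt (q2 j x) - Num.sqrt (nominal R p j)) ^+ 2.
    by rewrite /hellinger big_seq [RHS]big_seq; apply: eq_bigr => j jJ; rewrite shareE.
  apply: divergence_perturb_le => //.
  - by move=> j; exact: sectionr_ge0.
  - by move=> j; exact: sectionr_ge0.
  - by move=> j; rewrite invr_ge0.
  - exact: sum1.
  - exact: sum1.
  - rewrite -(sum_share R p l) big_seq [RHS]big_seq.
    by apply: eq_bigr => j jJ; rewrite shareE.
apply: le_trans step _; apply: leeD => //.
apply: (@le_trans _ _ ((2 * s)%:E + (2 / s)%:E * h%:E)%E).
  by rewrite leeD2l // lee_wpmul2l // lee_fin divr_ge0 // ltW.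
by rewrite -EFinM -EFinD lee_fin addr0.
Qed.
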